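(* The fibers of the Springer resolution $\pi:\widetilde{\mathcal{N}}_1\to\mathcal{N}_1$ of the odd nilpotent cone of $\mathfrak{osp}(2n+1,2n)$ are, in general, neither connected nor equidimensional: there exist $n\ge 1$ and $X\in\mathcal{N}_1$ such that $\pi^{-1}(X)$ is not connected, and there exist $n\geq 1$ and $X\in\mathcal{N}_1$ such that $\pi^{-1}(X)$ is not equidimensional (i.e. its irreducible components do not all have the same dimension). In particular, the variety $\mathcal{N}_1$ is not normal (for every $n\ge1$).
   Context: We work over $\mathbb{C}$; $n\ge 1$. Let $V=V_0\oplus V_1$ be a $\mathbb{Z}/2\mathbb{Z}$-graded vector space with $\dim V_0=2n+1$, $\dim V_1=2n$, equipped with a bilinear form $B$ for which $V_0$ and $V_1$ are orthogonal, and whose restrictions $\varphi:V_0\to V_0^\vee$ and $\psi:V_1\to V_1^\vee$ are non-degenerate, respectively symmetric and alternating. For $u\in\mathrm{Hom}(V_0,V_1)$ let $u^*=\varphi^{-1}\circ u^t\circ\psi\in\mathrm{Hom}(V_1,V_0)$. The odd elements of $\mathfrak{osp}(2n+1,2n)$ are the endomorphisms $X=(u,u^* )$ of $V$ (acting as $u$ on $V_0$ and as $u^*$ on $V_1$), $u\in\mathrm{Hom}(V_0,V_1)$. The odd nilpotent cone $\mathcal{N}_1$ is the set of those $X=(u,u^* )$ that are nilpotent, viewed as a (reduced) closed subvariety of $\mathrm{Hom}(V_0,V_1)$. Let $G_0=\mathrm{O}(V_0,\varphi)$, $G_1=\mathrm{Sp}(V_1,\psi)$ with Borel subgroups $B_0,B_1$;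 $G_0/B_0$ (resp. $G_1/B_1$) is the variety of complete isotropic flags $(E_i)_{1\le i\le n}$ in $V_0$ (resp. $(F_j)_{1\le j\le n}$ in $V_1$), with $\dim E_i=i$, $\dim F_j=j$; set $E_0=F_0=0$. For $X=(u,u^* )\in\mathcal{N}_1$ let $B_X$ be the variety of pairs $((E_i),(F_j))\in G_0/B_0\times G_1/B_1$ such that $u(E_i)\subset F_{i-1}$ and $u^*(F_i)\subset E_i$ for all $i\in\{1,\dots,n\}$. Put $$\widetilde{\mathcal{N}}_1=\{(u,(E_i),(F_j))\in \mathrm{Hom}(V_0,V_1)\times G_0/B_0\times G_1/B_1 : u(E_i)\subset F_{i-1},\ u^*(F_i)\subset E_i \text{ for all } i\}$$ and let $\pi:\widetilde{\mathcal{N}}_1\to\mathcal{N}_1$ be the first projection. It is a resolution of singularities, and $\pi^{-1}(X)$ is identified with $B_X$. *)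

(* Defs.v *)
From HB Require Import structures.
From mathcomp Require Import all_boot all_order all_algebra complex.
From mathcomp Require Import mpoly.
From mathcomp Require Import boolp classical_sets reals topology.

Set Implicit Arguments.
Unset Strict Implicit.
Unset Printing Implicit Defensive.

Import GRing.Theory.

Local Open Scope ring_scope.
Local Open Scope classical_set_scope.

Section KrullDimension.
Variable T : topologicalType.
Implicit Types A B Z : set T.

Definition irreducible A : Prop :=
  A !=set0 /\
  forall F G : set T, closed F -> closed G ->
    A `<=` F `|` G -> A `<=` F \/ A `<=` G.

Definition irreducible_component Z A : Prop :=
  [/\ A `<=` Z, irreducible A &
      forall B, irreducible B -> A `<=` B -> B `<=` Z -> B = A].

Definition closed_in A B : Prop := exists2 F : set T, closed F & B = A `&` F.

Definition irreducible_chain A (d : nat) (c : nat -> set T) : Prop :=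
  (forall i, (i <= d)%N -> irreducible (c i) /\ closed_in A (c i)) /\
  (forall i, (i < d)%N -> c i `<` c i.+1).

Definition krull_dimension A (d : nat) : Prop :=
  (exists c, irreducible_chain A d c) /\
  ~ (exists c, irreducible_chain A d.+1 c).

Definition equidimensional Z : Prop :=
  exists d, forall A, irreducible_component Z A -> krull_dimension A d.

End KrullDimension.

(* Evaluation of a polynomial at a vector, through the coordinates in a basis *)
(* of [W]; the set of functions [peval p] does not depend on the basis.       *)
Definition peval (K : fieldType) (W : vectType K) (p : {mpoly K[\dim {:W}]})
  (w : W) : K := p.@[fun i => coord (vbasis {:W}) i w].

Section Normality.
Variables (K : fieldType) (W : vectType K).
Implicit Types (Z : set W) (x : W).

(* [D] is, via [h], the local ring at [x] of the reduced subvariety [Z] of    *)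
(* the affine space [W]: the localization of K[W]/I(Z) at the maximal ideal   *)
(* of the point [x].                                                          *)
Definition is_local_ring Z x (D : idomainType)
    (h : {rmorphism {mpoly K[\dim {:W}]} -> D}) : Prop :=
  [/\ forall p, h p = 0 <->
        (exists2 s, peval s x != 0 & forall z, Z z -> peval (s * p) z = 0),
      forall s, peval s x != 0 -> h s \is a GRing.unit &
      forall a, exists p s, peval s x != 0 /\ a = h p / h s].

Definition integrally_closed (D : idomainType) : Prop :=
  forall z : {fraction D}, integralOver (@tofrac D) z ->
    exists a : D, z = tofrac a.

Definition normal_variety Z : Prop :=
  forall x, Z x ->
    exists (D : idomainType) (h : {rmorphism {mpoly K[\dim {:W}]} -> D}),
      is_local_ring Z x h /\ integrally_closed D.

End Normality.

Section Flags.
Variables (K : fieldType) (n : nat) (V : vectType K).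

Definition is_flag (E : {ffun 'I_n.+1 -> {vspace V}}) : bool :=
  [forall i : 'I_n.+1, \dim (E i) == i] &&
  [forall i : 'I_n.+1, forall j : 'I_n.+1, (i <= j)%N ==> (E i <= E j)%VS].

(* Flags E_0 = 0, E_1, ..., E_n in [V] with dim E_i = i. *)
Record flag := Flag {
  flag_val :> {ffun 'I_n.+1 -> {vspace V}};
  flagP : is_flag flag_val }.

HB.instance Definition _ := [isSub for flag_val].
HB.instance Definition _ := [Choice of flag by <:].

(* Linear independence of [P] follows from the dimensions of the E_i. *)
Definition frame (P : {ffun 'I_n -> V}) (E : flag) : Prop :=
  forall i : 'I_n.+1, E i = (\sum_(j < n | (j < i)%N) <[P j]>)%VS.

End Flags.

Section FlagPairs.
Variables (K : fieldType) (n : nat) (V0 V1 : vectType K).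

Definition flag_pairs : Type := ('Hom(V0, V1) * flag n V0 * flag n V1)%type.

HB.instance Definition _ := Choice.on flag_pairs.

(* A vector space, of which the pairs of linearly independent families form   *)
(* an open subset; the latter is a principal bundle over [flag_pairs] for the *)
(* product of two groups of invertible triangular matrices.                   *)
Definition frame_pairs : vectType K :=
  ('Hom(V0, V1) * {ffun 'I_n -> V0} * {ffun 'I_n -> V1})%type.

(* The Zariski topology, as the quotient topology from frames to flags: a set *)
(* is closed when its inverse image among frames is cut out by polynomials.   *)
Definition zariski_closed (A : set flag_pairs) : Prop :=
  exists S : set {mpoly K[\dim {:frame_pairs}]},
  forall u P Q (E : flag n V0) (F : flag n V1), frame P E -> frame Q F ->
    A (u, E, F) <->
    (forall p, S p -> @peval K frame_pairs p (u, P, Q) = 0).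

Let zopen (A : set flag_pairs) := zariski_closed (~` A).

Let zopenT : zopen setT.
Proof.
exists [set 1] => u P Q E F _ _; rewrite setCT; split=> // /(_ 1 erefl).
by rewrite /peval rmorph1 => /eqP; rewrite oner_eq0.
Qed.

Let zopenI A B : zopen A -> zopen B -> zopen (A `&` B).
Proof.
move=> [S hS] [S' hS'].
exists [set r | exists p q, [/\ S p, S' q & r = p * q]] => u P Q E F hP hQ.
rewrite setCI; split.
  move=> AB _ [p [q [Sp Sq ->]]]; rewrite /peval rmorphM /=.
  case: AB => [/(hS _ _ _ _ _ hP hQ)/(_ _ Sp)|/(hS' _ _ _ _ _ hP hQ)/(_ _ Sq)];
    by rewrite /peval => ->; rewrite ?mul0r ?mulr0.
move=> h; have [cA|ncA] := pselect ((~` A) (u, E, F)); first by left.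
right; apply/(hS' _ _ _ _ _ hP hQ) => q Sq; apply: contrapT => /eqP q0.
have /existsNP[p /not_implyP[Sp /eqP p0]] :
    ~ forall p, S p -> @peval K frame_pairs p (u, P, Q) = 0.
  by move=> hp; apply: ncA; apply/(hS _ _ _ _ _ hP hQ).
have := h _ (ex_intro _ p (ex_intro _ q (And3 Sp Sq erefl))).
by rewrite /peval rmorphM => /eqP; rewrite mulf_eq0 (negbTE p0) (negbTE q0).
Qed.

Let zopen_bigU (I : Type) (f : I -> set flag_pairs) :
  (forall i, zopen (f i)) -> zopen (\bigcup_i f i).
Proof.
move=> /choice[S hS]; exists (\bigcup_i S i) => u P Q E F hP hQ.
rewrite setC_bigcup; split=> [h p [i _ Sp]|h i _].
  by have /(hS i _ _ _ _ _ hP hQ) := h i Logic.I; apply.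
by apply/(hS i _ _ _ _ _ hP hQ) => p Sp; apply: h; exists i.
Qed.

HB.instance Definition _ :=
  isOpenTopological.Build flag_pairs zopenT zopenI zopen_bigU.

Lemma closed_flag_pairsE (A : set flag_pairs) : closed A <-> zariski_closed A.
Proof. by rewrite -openC; rewrite -{2}(setCK A). Qed.

End FlagPairs.

Section OddNilpotentCone.
Variables (K : fieldType) (V0 V1 : vectType K).

Definition dual (V : vectType K) : vectType K := 'Hom(V, K^o).

Definition transpose (u : 'Hom(V0, V1)) : 'Hom(dual V1, dual V0) :=
  linfun (fun xi : dual V1 => (xi \o u)%VF).

Variables (phi : 'Hom(V0, dual V0)) (psi : 'Hom(V1, dual V1)).

Definition osp_form (n : nat) : Prop :=
  [/\ \dim {:V0} = (2 * n + 1)%N, \dim {:V1} = (2 * n)%N,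
      (forall x y, phi x y = phi y x) /\ lker phi = 0%VS &
      (forall x, psi x x = 0) /\ lker psi = 0%VS].

Definition adj (u : 'Hom(V0, V1)) : 'Hom(V1, V0) :=
  (phi^-1 \o transpose u \o psi)%VF.

Definition odd_endo (u : 'Hom(V0, V1)) (v : V0 * V1) : V0 * V1 :=
  (adj u v.2, u v.1).

Definition odd_nilcone : set 'Hom(V0, V1) :=
  [set u | exists k, forall v, iter k (odd_endo u) v = 0].

Definition isotropic (V : vectType K) (b : 'Hom(V, dual V)) (U : {vspace V}) :=
  forall x y, x \in U -> y \in U -> b x y = 0.

(* With 1-based indices: u(E_i) is in F_{i-1} and u^*(F_i) in E_i, 1 <= i <= n. *)
Definition springer_space (n : nat) : set (flag_pairs n V0 V1) :=
  [set z : flag_pairs n V0 V1 | let: (u, E, F) := z in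
    [/\ forall i, isotropic phi (E i), forall i, isotropic psi (F i) &
        forall i : 'I_n,
          (u @: E (lift ord0 i) <= F (widen_ord (leqnSn n) i))%VS /\
          (adj u @: F (lift ord0 i) <= E (lift ord0 i))%VS]].

Definition springer_map n (z : flag_pairs n V0 V1) : 'Hom(V0, V1) := z.1.1.

Definition springer_fiber n (u : 'Hom(V0, V1)) : set (flag_pairs n V0 V1) :=
  @springer_space n `&` @springer_map n @^-1` [set u].

End OddNilpotentCone.

Arguments springer_space {K V0 V1} phi psi n _.
Arguments springer_fiber {K V0 V1} phi psi n u _.

(* Main.v *)
(* Choose hyperbolic bases e_0, ..., e_2n of V_0 and g_0, ..., g_(2n-1) of V_1.

   Non-normality.  Put Z = u^* u, and let w_i = Z^i v for i <> n, while
   w_n = Z^(n-1) u^* b, for fixed v in V_0 and b in V_1.  On the nilpotent cone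
   the Gram matrix of w_0, ..., w_2n is antitriangular, so that the square of
   beta = det (phi (w_i, e_j)) is, up to a sign, phi (w_n, w_n) alpha^2 with
   alpha = phi (v, Z^(2n) v)^n.  Hence beta / alpha is integral over the
   coordinate ring.  (For nilpotent u of maximal rank it is the pairing of w_n
   with the generator of the line E_n^perp / E_n fixed by an orientation of V_0.)
   Let u_0 map e_i to g_i for 0 < i < 2n and kill e_0 and e_2n.  Mapping e_0, or
   instead e_2n, to t g_0 deforms u_0 along two lines inside the cone, which are
   exchanged by a reflection of V_0; so beta / alpha takes opposite nonzero
   values along them and is not regular at u_0.

   Disconnectedness.  For n = 1 the fiber over u_0 has two points, E_1 being one
   of the two isotropic lines <e_0> and <e_2>.

   Failure of equidimensionality.  For n = 2 let u map e_i to g_i for i < 3 and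
   kill e_3 and e_4.  In the closed subset E_2 = <e_3, e_4> the fiber contains
   a surface; its complement is the affine line
     E_1 = <e_3>, E_2 = <e_3, e_0 + y e_2 - y^2/2 e_4>,
     F_1 = <g_0 + y g_2>, F_2 = <g_0, g_2>,
   whose closure adds the single point y = oo. *)

From HB Require Import structures.
Require Import Defs.
From mathcomp Require Import all_boot all_order all_algebra all_fingroup complex.
From mathcomp Require Import mpoly.
From mathcomp Require Import boolp classical_sets reals topology.
From mathcomp Require Import ring zify.

Set Implicit Arguments.
Unset Strict Implicit.
Unset Printing Implicit Defensive.
Import GRing.Theory Num.Theory.
Local Open Scope ring_scope.
Local Open Scope classical_set_scope.

(** * Polynomial functions on a vector space *)

Section PolynomialFunctions.
Variables (K : fieldType) (W : vectType K).
Implicit Types (f g : W -> K).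

Definition polyfun f := exists p, forall w, @peval K W p w = f w.

Lemma pevalM (p q : {mpoly K[\dim {:W}]}) (w : W) : peval (p * q) w = peval p w * peval q w.
Proof. by rewrite /peval mevalM. Qed.

Lemma pevalB (p q : {mpoly K[\dim {:W}]}) (w : W) : peval (p - q) w = peval p w - peval q w.
Proof. by rewrite /peval mevalB. Qed.

Lemma polyfun_ext f g : f =1 g -> polyfun f -> polyfun g.
Proof. by move=> fg [p hp]; exists p => w; rewrite hp. Qed.

Lemma polyfun_cst a : polyfun (fun=> a).
Proof. by exists (mpolyC _ a) => w; rewrite /peval mevalC. Qed.

Lemma polyfunD f g : polyfun f -> polyfun g -> polyfun (fun w => f w + g w).
Proof.
move=> [p hp] [q hq]; exists (p + q) => w.
by rewrite -hp -hq /peval mevalD.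
Qed.

Lemma polyfunM f g : polyfun f -> polyfun g -> polyfun (fun w => f w * g w).
Proof. by move=> [p hp] [q hq]; exists (p * q) => w; rewrite -hp -hq pevalM. Qed.

Lemma polyfun_sum I (r : seq I) (F : I -> W -> K) :
  (forall i, polyfun (F i)) -> polyfun (fun w => \sum_(i <- r) F i w).
Proof.
move=> hF; elim: r => [|i r IH].
  by apply: polyfun_ext (polyfun_cst 0) => w; rewrite big_nil.
by apply: polyfun_ext (polyfunD (hF i) IH) => w; rewrite big_cons.
Qed.

Lemma polyfun_prod I (r : seq I) (F : I -> W -> K) :
  (forall i, polyfun (F i)) -> polyfun (fun w => \prod_(i <- r) F i w).
Proof.
move=> hF; elim: r => [|i r IH].
  by apply: polyfun_ext (polyfun_cst 1) => w; rewrite big_nil.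
by apply: polyfun_ext (polyfunM (hF i) IH) => w; rewrite big_cons.
Qed.

Lemma polyfunX f k : polyfun f -> polyfun (fun w => f w ^+ k).
Proof.
move=> hf; apply: polyfun_ext (polyfun_prod (index_enum 'I_k) (fun=> hf)) => w.
by rewrite prodr_const card_ord.
Qed.

Lemma polyfun_det m (M : W -> 'M[K]_m) :
  (forall i j, polyfun (fun w => M w i j)) -> polyfun (fun w => \det (M w)).
Proof.
move=> hM; apply: polyfun_sum => s; apply: polyfunM; first exact: polyfun_cst.
exact: polyfun_prod.
Qed.

Lemma scalar_sum (U : vectType K) (l : U -> K) I (r : seq I) (c : I -> K) v :
  scalar l -> l (\sum_(i <- r) c i *: v i) = \sum_(i <- r) c i * l (v i).
Proof.
move=> hl; have l0 : l 0 = 0.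
  by have := hl (-1) 0 0; rewrite scaler0 addr0 => {1}->; ring.
by elim/big_rec2: _ => [|i y x _ <-]; rewrite ?l0 // hl.
Qed.

Lemma polyfun_scalar l : scalar l -> polyfun l.
Proof.
move=> hl; exists (\sum_(i < \dim {:W}) l (vbasis {:W})`_i *: mpolyX _ (mnm1 i)) => w.
rewrite {2}(coord_vbasis (memvf w)) (scalar_sum _ _ _ hl) /peval.
rewrite rmorph_sum; apply: eq_bigr => i _ /=.
by rewrite mevalZ mevalXU mulrC.
Qed.

(** Phrased through all linear forms, so that the notion does not depend on a basis of [U]. *)
Definition polymap (U : vectType K) (F : W -> U) :=
  forall l : U -> K, scalar l -> polyfun (fun w => l (F w)).

Lemma polymap_cst (U : vectType K) (a : U) : polymap (fun=> a).
Proof. by move=> l _; exact: polyfun_cst. Qed.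

Lemma coord_scalar (U : vectType K) m (X : m.-tuple U) i : scalar (coord X i).
Proof. by move=> a x y; rewrite linearP. Qed.

(** Expanding [F w] in a basis of [U] gives a sum of products of two polynomial functions. This
    serves for the value of [u], or of its adjoint, at a vector that varies with [u]: the operator
    applied is itself the variable. *)
Lemma polymap_apply (U U' : vectType K) (T : W -> U -> U') (F : W -> U) :
    (forall w, linear (T w)) -> (forall x, linear (T^~ x)) ->
  polymap F -> polymap (fun w => T w (F w)).
Proof.
move=> T1 T2 hF l hl.
apply: (@polyfun_ext (fun w => \sum_i coord (vbasis {:U}) i (F w) *
                                 l (T w (vbasis {:U})`_i))) => [w|].
  have hlT : scalar (fun x => l (T w x)) by move=> a x y; rewrite T1 hl.
  by rewrite -(scalar_sum _ _ _ hlT) -(coord_vbasis (memvf (F w))).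
apply: polyfun_sum => i; apply: polyfunM; first exact/hF/coord_scalar.
by apply: polyfun_scalar => a x y; rewrite T2 hl.
Qed.

End PolynomialFunctions.

(** * Polynomial curves in a vector space and specialization along them *)

Section PolynomialCurves.
Variables (K : numFieldType) (W : vectType K).

Definition polycurve (c : K -> W) :=
  forall l : W -> K, scalar l -> exists q : {poly K}, forall t, l (c t) = q.[t].

Lemma peval_polycurve (c : K -> W) p :
  polycurve c -> exists q : {poly K}, forall t, peval p (c t) = q.[t].
Proof.
move=> hc.
have /boolp.choice[q hq] i := hc _ (coord_scalar (vbasis {:W}) i).
exists (\sum_(m <- msupp p) mcoeff m p *: \prod_i q i ^+ m i) => t.
rewrite /peval mevalE horner_sum; apply: eq_bigr => m _.
rewrite hornerZ horner_prod; congr (_ * _); apply: eq_bigr => i _.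
by rewrite horner_exp hq.
Qed.

Lemma polycurve_line (x w : W) : polycurve (fun t => x + t *: w).
Proof.
move=> l hl; exists ((l x)%:P + l w *: 'X) => t.
by rewrite addrC hl !hornerE addrC mulrC.
Qed.

Lemma polynomial_punctured_eq0 (q : {poly K}) :
  (forall t, t != 0 -> q.[t] = 0) -> q = 0.
Proof.
move=> hq; apply/eqP/negPn/negP => q0.
(* In characteristic 0 the points 1, ..., [size q] are distinct and nonzero, and a nonzero [q] has
   fewer than [size q] roots. *)
have := @max_poly_roots _ q [seq i.+1%:R | i <- iota 0 (size q)] q0.
rewrite size_map size_iota ltnn => H; suff: false by []; apply: H.
  by apply/allP => _ /mapP[i _ ->]; apply/rootP/hq; rewrite pnatr_eq0.
rewrite map_inj_uniq ?iota_uniq // => i j /eqP.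
by rewrite eqr_nat => /eqP[].
Qed.

(** Passage to the limit [t = 0] in algebraic form: along the curve [f] is a polynomial in [t] with
    infinitely many zeros. *)
Lemma polyfun_curve_punctured_eq0 (f : W -> K) (c : K -> W) :
  polyfun f -> polycurve c -> (forall t, t != 0 -> f (c t) = 0) -> f (c 0) = 0.
Proof.
move=> [p hp] /(peval_polycurve p)[q hq] f0.
rewrite -hp hq (polynomial_punctured_eq0 (q := q)) ?horner0 // => t t0.
by rewrite -hq hp f0.
Qed.

End PolynomialCurves.

(** * A criterion for non-normality at a point where two branches meet *)

Section NonNormality.
Variables (K : numFieldType) (W : vectType K).

(* The rational function [beta / alpha] is integral, being a square root of    *)
(* [N], but along the two branches [x + t w1], [x + t w2] through [x] its      *)
(* values are opposite: it cannot be regular at [x].                           *)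
Lemma not_normal_of_branches (Z : set W) (x w1 w2 : W) (alpha beta N : W -> K) :
    polyfun alpha -> polyfun beta -> polyfun N ->
    (forall t, Z (x + t *: w1)) -> (forall t, Z (x + t *: w2)) ->
    (forall z, Z z -> beta z ^+ 2 = N z * alpha z ^+ 2) ->
    (forall t, t != 0 -> alpha (x + t *: w1) != 0) ->
    (forall t, t != 0 -> alpha (x + t *: w2) = alpha (x + t *: w1) /\
                         beta (x + t *: w2) = - beta (x + t *: w1)) ->
    N x != 0 ->
  ~ normal_variety Z.
Proof.
move=> [a ha] [b hb] [c hc] Z1 Z2 sq al0 opp Nx0 /(_ x).
have Zx : Z x by have := Z1 0; rewrite scale0r addr0.
case=> // D [h [[kerh unith frach] intD]].
have c1 := polycurve_line x w1; have c2 := polycurve_line x w2.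
have at0 w : x = x + 0 *: w by rewrite scale0r addr0.
have polyp p : polyfun (@peval K W p) by exists p.
(* If [s * a] vanished on [Z], then [s] would vanish on the first branch for [t != 0], where [alpha]
   is nonzero, and hence at [x]. *)
have hal : h a != 0.
  apply/eqP => /kerh[s sx sa]; case/eqP: sx.
  rewrite (at0 w1); apply: (polyfun_curve_punctured_eq0 (polyp s) c1) => t t0.
  have /eqP := sa _ (Z1 t); rewrite pevalM ha mulf_eq0 (negbTE (al0 _ t0)) orbF.
  by move/eqP.
have hsq : h b ^+ 2 = h c * h a ^+ 2.
  apply/eqP; rewrite -subr_eq0 -!rmorphXn -rmorphM -rmorphB; apply/eqP/kerh.
  exists 1 => [|z Zz]; first by rewrite /peval rmorph1 oner_eq0.
  by rewrite mul1r pevalB pevalM !expr2 !pevalM hb hc ha -!expr2 sq ?subrr.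
(* [beta / alpha] is a root of the monic polynomial [X^2 - N], hence lies in the local ring. *)
have [|g hg] := intD (tofrac (h b) / tofrac (h a)).
  exists ('X^2 - (h c)%:P); first by rewrite monicE lead_coefXnsubC.
  rewrite rmorphB /= map_polyXn map_polyC /= rootE !hornerE expr_div_n.
  rewrite -!tofracXn hsq tofracM mulfK ?subrr //.
  by rewrite tofrac_eq0 expf_neq0.
have {hg} hg : h b = g * h a.
  apply/eqP; rewrite -tofrac_eq tofracM -hg divfK //.
  by rewrite tofrac_eq0.
have [p [s [sx gE]]] := frach g.
have: h (b * s - p * a) = 0.
  rewrite rmorphB !rmorphM hg gE mulrAC divrK ?unith // mulrC.
  by rewrite subrr.
move=> /kerh[s' s'x rel].
(* After clearing denominators, [P / S] represents [beta / alpha] near [x]: [S beta = P alpha] on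
   [Z], with [S x] nonzero. *)
pose P w := peval (s' * p) w; pose S w := peval (s' * s) w.
have PS z : Z z -> S z * beta z = P z * alpha z.
  move=> /rel; rewrite /S /P !pevalM pevalB !pevalM ha hb => /eqP.
  rewrite mulrBr subr_eq0 => /eqP E.
  by rewrite mulrAC -mulrA E mulrA.
have Sx0 : S x != 0 by rewrite /S pevalM mulf_neq0.
have [fP fS] : polyfun P /\ polyfun S by split; apply: polyp.
(* Along the first branch [alpha^2] cancels from [P^2 alpha^2 = N S^2 alpha^2]; the limit is the
   identity at [x]. *)
have E1 : P x * P x - N x * S x * S x = 0.
  rewrite (at0 w1).
  have fE : polyfun (fun z => P z * P z - N z * S z * S z).
    apply: polyfunD; first exact: polyfunM.
    apply: (@polyfun_ext _ _ (fun z => -1 * (N z * S z * S z))) => [z|].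
      by rewrite mulN1r.
    apply: polyfunM; first exact: polyfun_cst.
    by do 2![apply: polyfunM => //]; exists c.
  apply: (polyfun_curve_punctured_eq0 fE c1) => t t0.
  set z := x + t *: w1; have hz := PS _ (Z1 t); have sz := sq _ (Z1 t).
  have az := al0 _ t0; rewrite -/z in hz sz az.
  apply: (mulIf (expf_neq0 2 az)); rewrite mul0r mulrBl -expr2 -exprMn -hz.
  rewrite exprMn sz; ring.
(* The mixed products of [P] on one branch with [S] on the other cancel, because [beta / alpha]
   changes sign between the branches. *)
have E2 : 2 * (P x * S x) = 0.
  pose f t := P (x + t *: w1) * S (x + t *: w2) + P (x + t *: w2) * S (x + t *: w1).
  have fE : f 0 = 2 * (P x * S x) by rewrite /f !scale0r !addr0 mulr2n mulrDl mul1r.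
  have [q hq] : exists q : {poly K}, forall t, f t = q.[t].
    have [p1 h1] := peval_polycurve (s' * p) c1.
    have [p2 h2] := peval_polycurve (s' * p) c2.
    have [s1 h3] := peval_polycurve (s' * s) c1.
    have [s2 h4] := peval_polycurve (s' * s) c2.
    by exists (p1 * s2 + p2 * s1) => t; rewrite !hornerE -h1 -h2 -h3 -h4.
  rewrite -fE hq (polynomial_punctured_eq0 (q := q)) ?horner0 // => t t0.
  rewrite -hq /f; have h1 := PS _ (Z1 t); have h2 := PS _ (Z2 t).
  have [e1 e2] := opp _ t0; have az := al0 _ t0.
  rewrite e1 e2 in h2.
  apply: (mulIf az); rewrite mul0r mulrDl [X in X + _]mulrAC [X in _ + X]mulrAC.
  rewrite -h1 -h2; ring.
have Px0 : P x = 0.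
  by move/eqP: E2; rewrite !mulf_eq0 pnatr_eq0 (negbTE Sx0) orbF => /eqP.
move/eqP: E1; rewrite Px0 mul0r sub0r oppr_eq0 !mulf_eq0.
by rewrite (negbTE Nx0) (negbTE Sx0).
Qed.

End NonNormality.

(** * Hyperbolic bases *)

Section BilinearForms.
Variables (K : fieldType) (V : vectType K) (phi : 'Hom(V, dual V)).

Lemma bformDl x y z : phi (x + y) z = phi x z + phi y z.
Proof. by rewrite linearD add_lfunE. Qed.

Lemma bformZl a x z : phi (a *: x) z = a * phi x z.
Proof. by rewrite linearZ scale_lfunE. Qed.

Lemma bformDr x y z : phi x (y + z) = phi x y + phi x z.
Proof. exact: linearD. Qed.

Lemma bformZr a x z : phi x (a *: z) = a * phi x z.
Proof. exact: linearZ. Qed.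

Lemma bform0l x : phi 0 x = 0.
Proof. by rewrite linear0 zero_lfunE. Qed.

Lemma bform0r x : phi x 0 = 0.
Proof. exact: linear0. Qed.

Lemma bformNl x z : phi (- x) z = - phi x z.
Proof. by rewrite -scaleN1r bformZl mulN1r. Qed.

Lemma bformNr x z : phi x (- z) = - phi x z.
Proof. by rewrite -scaleN1r bformZr mulN1r. Qed.

Lemma bform_sumr x I (r : seq I) (c : I -> K) v :
  phi x (\sum_(i <- r) c i *: v i) = \sum_(i <- r) c i * phi x (v i).
Proof. by apply: scalar_sum => a y z; rewrite bformDr bformZr. Qed.

Lemma bform_suml y I (r : seq I) (c : I -> K) v :
  phi (\sum_(i <- r) c i *: v i) y = \sum_(i <- r) c i * phi (v i) y.
Proof. by apply: (@scalar_sum _ _ (phi^~ y)) => a x z; rewrite bformDl bformZl. Qed.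

Definition bformE := (bformDl, bformZl, bformDr, bformZr, bform0l, bform0r, bformNl, bformNr).

(** The Gram matrix is antidiagonal: [i + j.+1 == m] pairs an index with its mirror image. Taking
    [eta] to be 1 or -1 covers symmetric and alternating forms at once; for odd [m] the middle
    vector has square 1. *)
Definition hyperbolic_family (eta : K) m (e : nat -> V) := forall i j, (i < m)%N -> (j < m)%N ->
  phi (e i) (e j) = if (i + j.+1 == m)%N then (if (i <= j)%N then 1 else eta) else 0.

End BilinearForms.

Section HyperbolicBasis.
Variables (K : numClosedFieldType) (V : vectType K) (phi : 'Hom(V, dual V)).
Variable eta : K.
Hypotheses (eta2 : eta * eta = 1) (phiC : forall x y, phi y x = eta * phi x y).
Hypothesis phi_alt : eta != 1 -> forall x, phi x x = 0.

Let nondegenerate_on (U : {vspace V}) :=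
  forall x, x \in U -> (forall y, y \in U -> phi x y = 0) -> x = 0.

Lemma exists_isotropic (U : {vspace V}) : (1 < \dim U)%N ->
  exists2 x, x \in U & x != 0 /\ phi x x = 0.
Proof.
move=> dU; have [a aU a0] : exists2 a, a \in U & a != 0.
  by exists (vpick U); rewrite ?memv_pick // vpick0 -dimv_eq0 -lt0n ltnW.
have /subvPn[b bU ba] : ~~ (U <= <[a]>)%VS.
  by apply/negP => /dimvS; rewrite dim_vline a0 leqNgt dU.
have [bb|bb] := eqVneq (phi b b) 0.
  exists b => //; split=> //.
  by apply: contraNneq ba => ->; rewrite mem0v.
have [e1|e1] := eqVneq eta 1; last by exists a => //; split=> //; apply: phi_alt.
have ab : phi b a = phi a b by rewrite phiC e1 mul1r.
(* [t] is a root of the quadratic polynomial [phi (a + t b) (a + t b)], and [d] is a square root of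
   a quarter of its discriminant. *)
pose d := sqrtC (phi a b ^+ 2 - phi a a * phi b b).
pose t := (d - phi a b) / phi b b.
exists (a + t *: b); first by rewrite rpredD ?rpredZ.
split.
  have [t0|t0] := eqVneq t 0; first by rewrite t0 scale0r addr0.
  apply: contraNneq ba => /eqP; rewrite addrC addr_eq0 => /eqP E.
  by rewrite -(scalerK t0 b) E rpredZ // rpredN memv_line.
rewrite !bformE ab; have dd : d ^+ 2 = phi a b ^+ 2 - phi a a * phi b b.
  by rewrite sqrtCK.
have tb : t * phi b b = d - phi a b by rewrite divfK.
apply: (mulfI bb); rewrite mulr0.
transitivity (phi a a * phi b b + 2 * phi a b * (t * phi b b) + (t * phi b b) ^+ 2).
  by ring.
by rewrite tb; transitivity (d ^+ 2 - (phi a b ^+ 2 - phi a a * phi b b));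
  [ring | rewrite dd subrr].
Qed.

Lemma hyperbolic_plane (U : {vspace V}) : (1 < \dim U)%N -> nondegenerate_on U ->
  exists x y, [/\ x \in U, y \in U, phi x x = 0, phi y y = 0 & phi x y = 1].
Proof.
move=> dU ndU; have [x xU [x0 xx]] := exists_isotropic dU.
have [z zU xz] : exists2 z, z \in U & phi x z != 0.
  apply: contrapT => H; case/eqP: x0; apply: ndU => // y yU.
  by apply/eqP/negPn/negP => xy; apply: H; exists y.
pose y := (phi x z)^-1 *: z.
have xy : phi x y = 1 by rewrite bformE mulVf.
have yU : y \in U by rewrite rpredZ.
(* In the symmetric case, subtracting this multiple of [x] makes the second vector isotropic and
   keeps its pairing with [x]. *)
clearbody y; exists x, (y - (phi y y / 2) *: x); split=> //.
- by rewrite rpredB ?rpredZ.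
- rewrite !bformE xx (phiC x y) xy.
  have [->|/phi_alt ->] := eqVneq eta 1; first by field.
  by rewrite mul0r; ring.
- by rewrite !bformE xx xy; ring.
Qed.

Lemma hyperbolic_complement (U : {vspace V}) x y :
    x \in U -> y \in U -> phi x x = 0 -> phi y y = 0 -> phi x y = 1 ->
    nondegenerate_on U ->
  exists U' : {vspace V}, [/\ \dim U = (\dim U').+2, (U' <= U)%VS,
    (forall z, z \in U' -> phi x z = 0 /\ phi y z = 0) & nondegenerate_on U'].
Proof.
move=> xU yU xx yy xy ndU.
have yx : phi y x = eta by rewrite phiC xy mulr1.
have eta0 : eta != 0.
  by apply: contra_eq_neq eta2 => ->; rewrite mul0r eq_sym oner_eq0.
pose U' := (U :&: lker (phi x : 'Hom(V, K^o)) :&: lker (phi y : 'Hom(V, K^o)))%VS.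
have inU' z : (z \in U') = [&& z \in U, phi x z == 0 & phi y z == 0].
  by rewrite !memv_cap !memv_ker andbA.
(* This is the projection of [U] to [U'] along the hyperbolic plane; [eta] compensates for
   [phi y x = eta]. *)
have dec u : u \in U -> u - phi x u *: y - (eta * phi y u) *: x \in U'.
  move=> uU; rewrite inU' !rpredB ?rpredZ //= !bformE xx yy xy yx.
  by apply/andP; split; apply/eqP; [ring | rewrite mulrAC eta2; ring].
have pairE a c : phi x (a *: x + c *: y) = c /\ phi y (a *: x + c *: y) = eta * a.
  by rewrite !bformE xx yy xy yx; split; ring.
have dxy : \dim (<[x]> + <[y]>) = 2%N.
  rewrite dimv_disjoint_sum ?dim_vline.
    have -> : x != 0 by apply: contra_eq_neq xy => ->; rewrite bform0l eq_sym oner_eq0.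
    by have -> : y != 0 by apply: contra_eq_neq xy => ->; rewrite bform0r eq_sym oner_eq0.
  apply/eqP; rewrite -subv0; apply/subvP => z /memv_capP[/vlineP[a ->] /vlineP[c E]].
  have := (pairE 0 c).1; rewrite scale0r add0r -E bformZr xx mulr0 => c0.
  by rewrite E -c0 scale0r mem0v.
exists U'; split.
- have -> : U = (<[x]> + <[y]> + U')%VS.
    apply/eqP; rewrite eqEsubv; apply/andP; split.
      apply/subvP => u uU.
      have -> : u = ((eta * phi y u) *: x + phi x u *: y) +
                    (u - phi x u *: y - (eta * phi y u) *: x).
        move: (phi x u *: y) (_ *: x) => p q.
        by rewrite addrC -[u - p - q]addrA -opprD (addrC p) subrK.
      by rewrite !memv_add ?dec // rpredZ ?memv_line.
    by rewrite !subv_add -!memvE xU yU /U' -capvA capvSl.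
  rewrite dimv_disjoint_sum ?dxy //.
  apply/eqP; rewrite -subv0; apply/subvP => z /memv_capP[/memv_addP[z1 /vlineP[a ->]]].
  move=> [z2 /vlineP[c ->] ->]; rewrite inU' => /and3P[_].
  have [-> ->] := pairE a c; rewrite mulf_eq0 (negbTE eta0) => /eqP-> /eqP->.
  by rewrite !scale0r addr0 mem0v.
- by rewrite /U' -capvA capvSl.
- by move=> z; rewrite inU' => /and3P[_ /eqP-> /eqP->].
- move=> z zU' H; apply: ndU => [|u uU]; first by move: zU'; rewrite inU' => /and3P[].
  have := H _ (dec _ uU); rewrite !bformE.
  move: zU'; rewrite inU' => /and3P[_ /eqP xz /eqP yz].
  by rewrite (phiC y z) (phiC x z) xz yz => <-; ring.
Qed.

(** Induction in steps of two: a hyperbolic plane is split off, and its two vectors are placed at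
    the two ends of a family for the complement. *)
Lemma exists_hyperbolic_family m (U : {vspace V}) :
    \dim U = m -> nondegenerate_on U ->
  exists2 e, (forall i, (i < m)%N -> e i \in U) & hyperbolic_family phi eta m e.
Proof.
elim/ltn_ind: m U => -[|[|m]] IH U dU ndU.
- by exists (fun=> 0).
- have [a aU a0] : exists2 a, a \in U & a != 0.
    by exists (vpick U); rewrite ?memv_pick // vpick0 -dimv_eq0 dU.
  have UE : U = <[a]>%VS.
    by apply/eqP; rewrite eq_sym eqEdim -memvE aU dU dim_vline a0.
  have aa : phi a a != 0.
    apply: contraNneq a0 => aa; apply/eqP; apply: ndU => // y.
    by rewrite UE => /vlineP[k ->]; rewrite bformZr aa mulr0.
  exists (fun=> (sqrtC (phi a a))^-1 *: a) => [i _|[|//] [|//] _ _ /=].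
    by rewrite rpredZ.
  by rewrite !bformE mulrA -expr2 exprVn sqrtCK mulVf.
- have [|x [y [xU yU xx yy xy]]] := hyperbolic_plane _ ndU; first by rewrite dU.
  have yx : phi y x = eta by rewrite phiC xy mulr1.
  have [U' [dU' sU' orth ndU']] := hyperbolic_complement xU yU xx yy xy ndU.
  have [||e eU' he] := IH m _ U' _ ndU'; [by rewrite leqW | by move: dU'; rewrite dU => -[] | ].
  exists (fun i => if i == 0%N then x else if i == m.+1 then y else e i.-1) => [i|i j].
    case: i => [|i] //=; rewrite !ltnS eqSS leq_eqVlt.
    by case: ltngtP => //= im _; apply: (subvP sU'); apply: eU'.
  have orthC z : z \in U' -> phi z x = 0 /\ phi z y = 0.
    by move=> /orth[h1 h2]; rewrite (phiC x z) (phiC y z) h1 h2 !mulr0.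
  case: i j => [|i] [|j]; rewrite ?ltnS ?addnS ?addSn ?add0n ?addn0 ?eqSS ?eqxx.
  + by rewrite xx.
  + move=> _; rewrite leq_eqVlt => /orP[/eqP->|jm]; first by rewrite eqxx.
    by rewrite (ltn_eqF jm); case: (orth _ (eU' _ jm)).
  + rewrite leq_eqVlt => /orP[/eqP->|im] _; first by rewrite eqxx.
    by rewrite (ltn_eqF im); case: (orthC _ (eU' _ im)).
  + rewrite leq_eqVlt => /orP[/eqP->|im]; rewrite leq_eqVlt => /orP[/eqP->|jm].
    * rewrite eqxx yy; case: eqP => // E; exfalso; lia.
    * rewrite eqxx (ltn_eqF jm); case: (orth _ (eU' _ jm)) => _ ->.
      case: eqP => // E; exfalso; lia.
    * rewrite eqxx (ltn_eqF im); case: (orthC _ (eU' _ im)) => _ ->.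
      case: eqP => // E; exfalso; lia.
    * by rewrite (ltn_eqF im) (ltn_eqF jm) he // addnS.
Qed.

End HyperbolicBasis.

(** * Adjoints *)

Section Iterates.
Variables (K : fieldType) (V : vectType K) (f : 'End(V)).

Lemma iter_scale_sum k I (r : seq I) (c : I -> K) (v : I -> V) :
  iter k f (\sum_(i <- r) c i *: v i) = \sum_(i <- r) c i *: iter k f (v i).
Proof.
elim: k => //= k ->; rewrite linear_sum; apply: eq_bigr => i _.
by rewrite linearZ.
Qed.

Lemma iter_scale k a v : iter k f (a *: v) = a *: iter k f v.
Proof. by elim: k => //= k ->; rewrite linearZ. Qed.

Lemma iter_0 k : iter k f 0 = 0.
Proof. by elim: k => //= k ->; rewrite linear0. Qed.

(** The images of the powers of [f] decrease and are constant once two consecutive ones agree; so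
    the dimension drops at each step until it is 0. This replaces an unspecified exponent by a
    uniform one. *)
Lemma nilpotent_iter_dim k : (forall v, iter k f v = 0) ->
  forall v, iter (\dim {:V}) f v = 0.
Proof.
move=> fk.
pose U j := iter j (lfun_img f) {:V}%VS.
have inU j v : iter j f v \in U j.
  by elim: j => [|j IH] /=; rewrite ?memvf // memv_img.
have Uk : U k = 0%VS.
  apply/eqP; rewrite -subv0; apply/subvP => v.
  have UE j w : w \in U j -> exists v', w = iter j f v'.
    elim: j w => [|j IH] w /=; first by exists w.
    by move=> /memv_imgP[w' /IH[v' ->] ->]; exists v'.
  by move=> /UE[v' ->]; rewrite fk mem0v.
have sub j : (U j.+1 <= U j)%VS.
  by elim: j => [|j IH]; rewrite ?subvf //= limgS.
have stable j i : U j.+1 = U j -> U (j + i)%N = U j.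
  move=> E; elim: i => [|i IH]; first by rewrite addn0.
  by rewrite addnS -[LHS]/(f @: U (j + i)%N)%VS IH.
have dimU j : (\dim (U j) <= \dim {:V} - j)%N.
  elim: j => [|j IH]; first by rewrite subn0.
  have [E|ne] := eqVneq (U j.+1) (U j).
    have : U (k + j)%N = 0%VS.
      by elim: j {IH E} => [|j IH]; rewrite ?addn0 // addnS /= -/(U _) IH limg0.
    by rewrite addnC stable // => U0; rewrite E U0 dimv0.
  have : (\dim (U j.+1) < \dim (U j))%N.
    by rewrite ltn_neqAle dimvS // andbT (dimv_leqif_eq (sub j)).
  lia.
move=> v; apply/eqP; rewrite -memv0; have := inU (\dim {:V}) v.
have := dimU (\dim {:V}); rewrite subnn leqn0 dimv_eq0 => /eqP->.
by [].
Qed.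

End Iterates.

Section FullHyperbolicFamily.
Variables (K : fieldType) (V : vectType K) (phi : 'Hom(V, dual V)) (eta : K).
Hypothesis eta2 : eta * eta = 1.
Variables (m : nat) (e : nat -> V).
Hypotheses (dV : \dim {:V} = m) (he : hyperbolic_family phi eta m e).

Definition family_tuple := [tuple e i | i < m].

Lemma family_tupleE (i : 'I_m) : family_tuple`_i = e i.
Proof. by rewrite -tnth_nth tnth_mktuple. Qed.

Lemma form_opposite i : (i < m)%N ->
  phi (e i) (e (m - i.+1)%N) * phi (e i) (e (m - i.+1)%N) = 1.
Proof.
move=> im; rewrite he //; last by lia.
have -> : (i + (m - i.+1).+1 == m)%N by lia.
by case: ifP; rewrite ?mulr1.
Qed.

Lemma form_family_neq i j : (i < m)%N -> (j < m)%N -> (i + j.+1 != m)%N ->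
  phi (e i) (e j) = 0.
Proof. by move=> im jm ne; rewrite he // (negbTE ne). Qed.

Lemma family_basis : basis_of {:V} family_tuple.
Proof.
rewrite basisEfree subvf size_tuple dV leqnn !andbT.
apply/freeP => k k0 i; have im : (m - i.+1 < m)%N by have := ltn_ord i; lia.
(* Pairing a linear relation with the vector opposite to [e i] isolates its [i]-th coefficient. *)
have := congr1 (fun x => phi x (e (m - i.+1)%N)) k0.
rewrite /= bform_suml bform0l (bigD1 i) //= big1 ?addr0.
  rewrite family_tupleE => /eqP; rewrite mulf_eq0 => /orP[/eqP//|/eqP E].
  by have := form_opposite (ltn_ord i); rewrite E mul0r => /esym/eqP; rewrite oner_eq0.
move=> j ji; rewrite family_tupleE form_family_neq ?mulr0 //.
by apply: contraNneq ji => E; apply/eqP/val_inj => /=; have := ltn_ord i; lia.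
Qed.

Lemma family_expand v : exists c : 'I_m -> K, v = \sum_i c i *: e i.
Proof.
exists (coord family_tuple ^~ v); rewrite {1}(coord_basis family_basis (memvf v)).
by apply: eq_bigr => i _; rewrite family_tupleE.
Qed.

Lemma form_family_inj x y :
  (forall j, (j < m)%N -> phi x (e j) = phi y (e j)) -> lker phi = 0%VS -> x = y.
Proof.
move=> H /eqP/lker0P inj; apply: inj; apply/lfunP => v.
have [c ->] := family_expand v; rewrite !bform_sumr; apply: eq_bigr => i _.
by rewrite H.
Qed.

Lemma hom_of_family (V' : vectType K) (w : nat -> V') :
  exists u : 'Hom(V, V'), forall i, (i < m)%N -> u (e i) = w i.
Proof.
pose F v := \sum_(i < m) coord family_tuple i v *: w i.
have F_lin : linear F.
  move=> a x y; rewrite /F scaler_sumr -big_split /=; apply: eq_bigr => i _.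
  by rewrite linearP scalerDl scalerA.
pose Fl := HB.pack_for {linear V -> V'} F (GRing.isLinear.Build K V V' _ F F_lin).
exists (linfun Fl) => i im; rewrite lfunE /= /F.
have -> : e i = family_tuple`_(Ordinal im) by rewrite family_tupleE.
have free_e := basis_free family_basis.
rewrite (bigD1 (Ordinal im)) // big1 ?addr0.
  by rewrite coord_free // eqxx /= scale1r addr0.
by move=> j ji; rewrite coord_free // eq_sym; move: ji => /= /negbTE->; rewrite scale0r.
Qed.

End FullHyperbolicFamily.

Section Adjoint.
Variables (K : fieldType) (V0 V1 : vectType K).
Variables (phi : 'Hom(V0, dual V0)) (psi : 'Hom(V1, dual V1)).
Hypothesis phi_nd : lker phi = 0%VS.
Implicit Type u : 'Hom(V0, V1).

(** [phi^-1] is only guaranteed to invert [phi] on its image; equality of dimensions makes this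
    image the whole dual. *)
Lemma form_surj : limg phi = fullv.
Proof.
apply/eqP; rewrite eqEdim subvf limg_dim_eq ?phi_nd ?capv0 //.
by rewrite !dimvf /dim /= muln1.
Qed.

(** [linfun] of a bare function returns its values only once the function is known to be linear. *)
Lemma transposeE u (xi : dual V1) : transpose u xi = (xi \o u)%VF.
Proof.
have lin : linear (fun xi : dual V1 => (xi \o u)%VF : dual V0).
  by move=> a x y; rewrite comp_lfunDl comp_lfunZl.
pose F := HB.pack_for {linear dual V1 -> dual V0} (fun xi : dual V1 => (xi \o u)%VF : dual V0)
  (GRing.isLinear.Build K (dual V1) (dual V0) _ _ lin).
exact: (lfunE F).
Qed.

Lemma adjE u y x : phi (adj phi psi u y) x = psi y (u x).
Proof.
rewrite /adj !comp_lfunE limg_lfunVK ?form_surj ?memvf //.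
by rewrite transposeE comp_lfunE.
Qed.

Lemma adj_inj x y : (forall z, phi x z = phi y z) -> x = y.
Proof. by move/eqP/lker0P: phi_nd => inj H; apply: inj; apply/lfunP. Qed.

Lemma adj_linear_hom y : linear (fun u => adj phi psi u y).
Proof.
move=> a u u'; apply: adj_inj => z.
by rewrite !bformE !adjE add_lfunE scale_lfunE bformDr bformZr.
Qed.

End Adjoint.

(** * The odd nilpotent cone and its orientation *)

Section OspForm.
Variables (K : numClosedFieldType) (V0 V1 : vectType K) (n : nat).
Variables (phi : 'Hom(V0, dual V0)) (psi : 'Hom(V1, dual V1)).
Hypothesis osp : osp_form phi psi n.
Implicit Types (u : 'Hom(V0, V1)) (e : nat -> V0) (g : nat -> V1).

Lemma osp_phiC x y : phi x y = phi y x. Proof. by case: osp => _ _ [-> _]. Qed.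

Lemma osp_psixx x : psi x x = 0. Proof. by case: osp => _ _ _ [-> _]. Qed.

Lemma osp_psiC x y : psi y x = - psi x y.
Proof.
have := osp_psixx (x + y); rewrite !bformE !osp_psixx add0r addr0 => /eqP.
by rewrite addr_eq0 => /eqP->; rewrite opprK.
Qed.

Lemma osp_phi_nd : lker phi = 0%VS. Proof. by case: osp => _ _ [_ ->]. Qed.

Lemma osp_psi_nd : lker psi = 0%VS. Proof. by case: osp => _ _ _ [_ ->]. Qed.

Lemma osp_dim0 : \dim {:V0} = (2 * n).+1.
Proof. by case: osp => -> _ _ _; rewrite addn1. Qed.

Lemma osp_dim1 : \dim {:V1} = (2 * n)%N. Proof. by case: osp. Qed.

Definition osp_basis e g :=
  hyperbolic_family phi 1 (2 * n).+1 e /\ hyperbolic_family psi (-1) (2 * n) g.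

Lemma exists_osp_basis : exists e g, osp_basis e g.
Proof.
have [|x y|||e _ he] := @exists_hyperbolic_family _ _ phi 1 _ _ _ _ _ osp_dim0.
- by rewrite mulr1.
- by rewrite mul1r osp_phiC.
- by rewrite eqxx.
- move=> x _ H; apply: (@adj_inj _ _ phi) => [|z]; first exact: osp_phi_nd.
  by rewrite H ?memvf // bform0l.
have [|x y|||g _ hg] := @exists_hyperbolic_family _ _ psi (-1) _ _ _ _ _ osp_dim1.
- by rewrite mulrNN mulr1.
- by rewrite mulN1r osp_psiC.
- by move=> _; apply: osp_psixx.
- move=> x _ H; apply: (@adj_inj _ _ psi) => [|z]; first exact: osp_psi_nd.
  by rewrite H ?memvf // bform0l.
by exists e, g.
Qed.

Local Notation Z u := (adj phi psi u \o u)%VF.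
Local Notation Y u := (u \o adj phi psi u)%VF.

Lemma osp_adjE u y x : phi (adj phi psi u y) x = psi y (u x).
Proof. exact: adjE osp_phi_nd u y x. Qed.

(** Two steps of the odd endomorphism act as [u^* u] on [V0] and as [u u^*] on [V1], so nilpotency
    can be studied on each summand. *)
Lemma iter_odd_endo u k v :
  iter k.*2 (odd_endo phi psi u) v = (iter k (Z u) v.1, iter k (Y u) v.2).
Proof.
elim: k => [|k IH] /=; first by case: v.
by rewrite IH /odd_endo /= !comp_lfunE.
Qed.

Lemma iter_comp_adj u k x : iter k (Y u) (u x) = u (iter k (Z u) x).
Proof. by elim: k => //= k ->; rewrite !comp_lfunE. Qed.

(** The exponents are the dimensions of [V0] and [V1]. The one for [V1], smaller by one, is what
    kills the pairings with the middle vector of the orientation family. *)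
Lemma odd_nilcone_iter u : odd_nilcone phi psi u ->
  (forall k x, (2 * n < k)%N -> iter k (Z u) x = 0) /\
  (forall k y, (2 * n <= k)%N -> iter k (Y u) y = 0).
Proof.
case=> k hk; have h2 v : iter k.*2 (odd_endo phi psi u) v = 0.
  by rewrite -addnn iterD hk; elim: k {hk} => //= k ->.
have hZ x : iter k (Z u) x = 0 by have := congr1 fst (h2 (x, 0)); rewrite iter_odd_endo.
have hY y : iter k (Y u) y = 0 by have := congr1 snd (h2 (0, y)); rewrite iter_odd_endo.
split=> j v hj.
  by rewrite -(subnK hj) iterD -osp_dim0 (nilpotent_iter_dim hZ) iter_0.
by rewrite -(subnK hj) iterD -osp_dim1 (nilpotent_iter_dim hY) iter_0.
Qed.

(** It is enough that [Z u] be nilpotent, because [Y^(k+1) = u Z^k u^*]. *)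
Lemma odd_nilcone_chain u e g : osp_basis e g ->
    (forall i, (i <= 2 * n)%N -> exists d,
       Z u (e i) = if (i < 2 * n)%N then d *: e i.+1 else 0) ->
  odd_nilcone phi psi u.
Proof.
move=> [he _] hu; pose m := (2 * n).+1.
have hk k i : (i < m)%N -> (m <= i + k)%N -> iter k (Z u) (e i) = 0.
  elim: k i => [|k IH] i im mik; first by lia.
  rewrite iterSr; have [d ->] := hu _ im.
  case: ltnP => h; last by rewrite iter_0.
  by rewrite iter_scale IH ?scaler0 // addSnnS.
have hZ x : iter m (Z u) x = 0.
  have [c ->] := family_expand (mulr1 1) osp_dim0 he x.
  rewrite iter_scale_sum big1 // => i _.
  by rewrite hk ?scaler0 ?leq_addl.
exists m.+1.*2 => v; rewrite iter_odd_endo iterS hZ linear0 iterSr comp_lfunE.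
by rewrite iter_comp_adj hZ linear0.
Qed.

(** [Z u] is skew for [phi]: moving [u] and its adjoint across passes once through the alternating
    form. *)
Lemma form_iterC u k x y :
  phi (iter k (Z u) x) y = (-1) ^+ k * phi x (iter k (Z u) y).
Proof.
have Z1 x' y' : phi (Z u x') y' = - phi x' (Z u y').
  by rewrite !(comp_lfunE (adj phi psi u) u) osp_adjE osp_psiC -osp_adjE osp_phiC.
elim: k x y => [|k IH] x y; first by rewrite expr0 mul1r.
by rewrite iterS Z1 IH -iterSr exprS mulN1r mulNr.
Qed.

(** For a symmetric form, the dual basis of a hyperbolic basis is the same family in reverse
    order. *)
Lemma form_expand e x y : hyperbolic_family phi 1 (2 * n).+1 e ->
  phi x y = \sum_(k < (2 * n).+1) phi x (e k) * phi y (e (2 * n - k)%N).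
Proof.
move=> he; have [c ->] := family_expand (mulr1 1) osp_dim0 he y.
rewrite bform_sumr; apply: eq_bigr => k _; rewrite mulrC; congr (_ * _).
rewrite bform_suml (bigD1 k) //= big1 => [|j jk].
  have hk := ltn_ord k; rewrite addr0 he //; last by rewrite ltnS leq_subr.
  have -> : (k + (2 * n - k).+1 == (2 * n).+1)%N by lia.
  by rewrite if_same mulr1.
rewrite (form_family_neq he) ?mulr0 ?(ltn_ord j) //; first by rewrite ltnS leq_subr.
by apply: contraNneq jk => E; apply/eqP/val_inj => /=; have := ltn_ord k; lia.
Qed.

(** * The orientation family and the integral function [beta / alpha] *)

Section Orientation.
Variables (v : V0) (b : V1).

(** The middle vector starts from [b] instead of [v]: on the branches used below [Z^n v] becomes 0
    at [t = 0], while the square of this vector stays nonzero, as the criterion demands of [N] at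
    the branch point. *)
Definition orientation_family u i :=
  if i == n then iter n.-1 (Z u) (adj phi psi u b) else iter i (Z u) v.

Definition orientation_det e u :=
  \det (\matrix_(i < (2 * n).+1, j < (2 * n).+1) phi (orientation_family u i) (e j)).

Definition orientation_denom u := phi v (iter (2 * n) (Z u) v) ^+ n.

(** This is the factor [N] in [beta^2 = N alpha^2]; the signs come from the skewness of [Z u]. *)
Definition orientation_square u :=
  (\prod_(i < (2 * n).+1 | val i != n) (-1) ^+ i) *
  phi (orientation_family u n) (orientation_family u n).

(** By skewness all powers of [Z u] move to one side. Two ordinary vectors then meet [Z^(2n+1) = 0];
    if one of them is the middle vector, the pairing becomes one with [b] in [V1] and meets
    [Y^(2n) = 0]. *)
Lemma orientation_family_orth u i j : (0 < n)%N -> odd_nilcone phi psi u ->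
    (i <= 2 * n)%N -> (j <= 2 * n)%N -> (2 * n < i + j)%N ->
  phi (orientation_family u i) (orientation_family u j) = 0.
Proof.
move=> n0 /odd_nilcone_iter[Z0 Y0].
have mid k : (n < k)%N -> phi (iter n.-1 (Z u) (adj phi psi u b)) (iter k (Z u) v) = 0.
  move=> nk; rewrite form_iterC osp_adjE -iterD -iter_comp_adj Y0 ?bform0r ?mulr0 //.
  lia.
rewrite /orientation_family => hi hj hij; case: eqP => [ni|_]; case: eqP => [nj|_].
- lia.
- by apply: mid; lia.
- by rewrite osp_phiC mid //; lia.
- by rewrite form_iterC -iterD Z0 ?bform0r ?mulr0.
Qed.

Lemma orientation_det_sqr e u : (0 < n)%N -> hyperbolic_family phi 1 (2 * n).+1 e ->
  odd_nilcone phi psi u ->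
  orientation_det e u ^+ 2 = orientation_square u * orientation_denom u ^+ 2.
Proof.
move=> n0 he nu; rewrite /orientation_det; set M := \matrix_(i, j) _.
pose w := orientation_family u.
(* This is the Gram matrix of the family with one index reversed, so that antitriangular becomes
   triangular. *)
pose H : 'M[K]_((2 * n).+1) := \matrix_(i, j) phi (w j) (w (2 * n - i)%N).
pose s := perm (@rev_ord_inj (2 * n).+1).
have HE : H^T = M *m (row_perm s (col_perm s M))^T.
  apply/matrixP => i j; rewrite !mxE (form_expand _ _ he); apply: eq_bigr => k _.
  by rewrite !mxE !permE /= !subSS.
(* Rows and columns are reversed by the same permutation, so the signs cancel. *)
have detH : \det H = \det M ^+ 2.
  rewrite -det_tr HE det_mulmx det_tr row_permE col_permE !det_mulmx !det_perm.
  by rewrite odd_permV; case: (odd_perm s); rewrite ?expr0 ?expr1; ring.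
rewrite -detH det_trig; last first.
  apply/is_trig_mxP => i j ij; rewrite mxE; have := ltn_ord j.
  by move=> hj; apply: orientation_family_orth => //; lia.
(* The diagonal entry [n] is split off; each of the [2 n] others is [phi v (Z^(2n) v)] up to sign,
   and together they give [alpha^2]. *)
have nlt : (n < (2 * n).+1)%N by lia.
rewrite (bigD1 (Ordinal nlt)) //= mxE /=.
have -> : (2 * n - n = n)%N by lia.
rewrite /orientation_square mulrAC mulrC /orientation_denom -exprM; congr (_ * _).
transitivity (\prod_(i < (2 * n).+1 | i != Ordinal nlt)
                ((-1) ^+ i * phi v (iter (2 * n) (Z u) v))).
  apply: eq_bigr => i; rewrite -val_eqE /= => ni; rewrite mxE /w /orientation_family.
  have := ltn_ord i => hi; rewrite (negbTE ni) ifN; last by apply/eqP; move/eqP: ni; lia.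
  rewrite form_iterC -iterD; congr (_ * phi v (iter _ _ _)); lia.
rewrite big_split /= prodr_const; congr (_ * _ ^+ _).
by rewrite (eq_card (B := predC1 (Ordinal nlt))) // cardC1 card_ord; lia.
Qed.

Lemma polymap_iter (F : 'Hom(V0, V1) -> V0) k : polymap F -> polymap (fun u => iter k (Z u) (F u)).
Proof.
move=> hF; elim: k => //= k IH.
have h1 : polymap (fun u => u (iter k (Z u) (F u))).
  apply: polymap_apply IH => [u|x] a y z; first by rewrite linearP.
  by rewrite add_lfunE scale_lfunE.
move=> l hl; apply: polyfun_ext; last first.
  apply: (@polymap_apply _ _ _ _ (fun u y => adj phi psi u y)) h1 l hl => [u|y].
    by move=> a y z; rewrite linearP.
  exact: adj_linear_hom osp_phi_nd y.
by move=> u; rewrite /= comp_lfunE.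
Qed.

Lemma polymap_orientation_family i : polymap (orientation_family ^~ i).
Proof.
rewrite /orientation_family; case: eqP => _; apply: polymap_iter; last exact: polymap_cst.
move=> l hl; apply: polyfun_scalar => a u u'.
by rewrite (adj_linear_hom _ osp_phi_nd) hl.
Qed.

Lemma polyfun_form (F : 'Hom(V0, V1) -> V0) y : polymap F -> polyfun (fun u => phi (F u) y).
Proof. by move=> hF; apply: (hF (phi^~ y)) => a x z; rewrite bformDl bformZl. Qed.

Lemma polyfun_orientation_det e : polyfun (orientation_det e).
Proof.
apply: polyfun_det => i j.
have := polyfun_form (e j) (polymap_orientation_family i).
by apply: polyfun_ext => u; rewrite mxE.
Qed.

Lemma polyfun_orientation_denom : polyfun orientation_denom.
Proof.
apply: polyfunX; have := polyfun_form v (polymap_iter (2 * n) (@polymap_cst _ 'Hom(V0, V1) _ v)).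
by apply: polyfun_ext => u; rewrite osp_phiC.
Qed.

Lemma polyfun_orientation_square e : hyperbolic_family phi 1 (2 * n).+1 e ->
  polyfun orientation_square.
Proof.
move=> he; apply: polyfunM; first exact: polyfun_cst.
have := polymap_orientation_family n; set F := orientation_family ^~ n => hF.
have : polyfun (fun u => \sum_(k < (2 * n).+1) phi (F u) (e k) * phi (F u) (e (2 * n - k)%N)).
  by apply: polyfun_sum => k; apply: polyfunM; apply: polyfun_form.
by apply: polyfun_ext => u; rewrite -form_expand.
Qed.

End Orientation.
End OspForm.

(** * Two branches of the cone *)

Section Branches.
Variables (K : numClosedFieldType) (V0 V1 : vectType K) (n : nat).
Variables (phi : 'Hom(V0, dual V0)) (psi : 'Hom(V1, dual V1)).
Hypotheses (osp : osp_form phi psi n) (n0 : (0 < n)%N).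
Implicit Types (u : 'Hom(V0, V1)) (e : nat -> V0) (g : nat -> V1).

Local Notation Z u := (adj phi psi u \o u)%VF.

(** At [t = 0] this is [u_0]; varying [t] gives one branch through it. The other branch is the same
    condition for the basis with its ends exchanged. *)
Definition chain_hom e g (t : K) u := forall i, (i <= 2 * n)%N ->
  u (e i) = if i == 0%N then t *: g 0%N else if (i < 2 * n)%N then g i else 0.

(** The coefficient by which [Z u] takes each [e i] to the next vector. One [t] comes from
    [u (e 0)], the other from the adjoint at the last vector of [g], and the sign from the
    alternating form. *)
Definition chain_coef (t : K) i : K :=
  (if i == 0%N then t else 1) *
  ((if i.+1 == (2 * n)%N then t else 1) * (if (i < n)%N then 1 else -1)).

Lemma chain_adj e g t u k : osp_basis n phi psi e g -> chain_hom e g t u ->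
    (k < 2 * n)%N ->
  adj phi psi u (g k) =
    ((if k.+1 == (2 * n)%N then t else 1) * (if (k < n)%N then 1 else -1)) *: e k.+1.
Proof.
move=> [he hg] hu kn.
apply: (form_family_inj (mulr1 1) (osp_dim0 osp) he) (osp_phi_nd osp) => j jm.
rewrite (osp_adjE osp) bformZl he // hu // (fun_if (psi _)) bformZr.
rewrite (fun_if (psi _)) bform0r if_same.
have -> : (k.+1 + j.+1 == (2 * n).+1)%N = (k + j.+1 == 2 * n)%N by rewrite addSn eqSS.
have [j0|j0] := eqVneq j 0%N.
  rewrite j0 hg ?muln_gt0 //= addn1 leqn0.
  have [kn1|kn1] := eqVneq k.+1 (2 * n)%N; last by rewrite !mulr0.
  by rewrite (_ : (k < n)%N = false) 1?(_ : k == 0%N = false) ?mulr1 //; lia.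
have [jn|nj] := ltnP j (2 * n); last first.
  by rewrite (_ : (k + j.+1 == 2 * n)%N = false) ?mulr0 //; lia.
rewrite hg //; have [E|] := eqVneq (k + j.+1)%N (2 * n)%N; last by rewrite mulr0.
rewrite (_ : (k.+1 == 2 * n)%N = false); last by apply/eqP; move/eqP: j0; lia.
rewrite mulr1 mul1r (_ : (k <= j)%N = (k < n)%N) //; lia.
Qed.

Lemma chain_sq e g t u i : osp_basis n phi psi e g -> chain_hom e g t u ->
    (i <= 2 * n)%N ->
  Z u (e i) = if (i < 2 * n)%N then chain_coef t i *: e i.+1 else 0.
Proof.
move=> heg hu i2n; rewrite comp_lfunE hu // /chain_coef.
have [->|i0] := eqVneq i 0%N.
  by rewrite muln_gt0 n0 linearZ /= (chain_adj heg hu) ?muln_gt0 // scalerA n0.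
by case: ltnP => h; rewrite ?linear0 // mul1r (chain_adj heg hu).
Qed.

Lemma chain_nilcone e g t u : osp_basis n phi psi e g -> chain_hom e g t u ->
  odd_nilcone phi psi u.
Proof.
move=> heg hu; apply: (odd_nilcone_chain osp heg) => i i2n.
by exists (chain_coef t i); apply: chain_sq heg hu i2n.
Qed.

(** The starting vector is symmetric in the two ends of the basis, so it serves for both branches;
    its second term dies at the first application of [Z u]. *)
Lemma chain_iter e g t u k : osp_basis n phi psi e g -> chain_hom e g t u ->
    (0 < k <= 2 * n)%N ->
  iter k (Z u) (e 0%N + e (2 * n)%N) = (\prod_(i < k) chain_coef t i) *: e k.
Proof.
move=> heg hu; elim: k => // k IH /andP[_ k2n].
have [->|k0] := posnP k.
  rewrite big_ord1 iterS linearD /= !(chain_sq heg hu) // ltnn muln_gt0 n0.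
  by rewrite addr0.
rewrite iterS IH ?k0 ?(ltnW k2n) // linearZ /= (chain_sq heg hu (ltnW k2n)) k2n.
by rewrite big_ord_recr /= scalerA.
Qed.

(** The chain enters at [e 1] and stops at index [n] at the latest, so it meets neither a factor [t]
    nor a sign. *)
Lemma chain_iter_adj e g t u k : osp_basis n phi psi e g -> chain_hom e g t u ->
  (k < n)%N -> iter k (Z u) (adj phi psi u (g 0%N)) = e k.+1.
Proof.
move=> heg hu; elim: k => [|k IH] kn.
  rewrite (chain_adj heg hu) ?muln_gt0 // kn ifN ?mulr1 ?scale1r //.
  by apply/eqP; lia.
rewrite iterS (IH (ltnW kn)) (chain_sq heg hu); last by lia.
rewrite ifT; last by lia.
rewrite /chain_coef kn ifN; last by apply/eqP; lia.
by rewrite !mul1r scale1r.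
Qed.

Definition chain_family e t i :=
  if i == n then e n else
  if i == 0%N then e 0%N + e (2 * n)%N else (\prod_(i < i) chain_coef t i) *: e i.

Lemma chain_orientation_family e g t u i :
    osp_basis n phi psi e g -> chain_hom e g t u -> (i <= 2 * n)%N ->
  orientation_family n phi psi (e 0%N + e (2 * n)%N) (g 0%N) u i = chain_family e t i.
Proof.
move=> heg hu i2n; rewrite /orientation_family /chain_family; case: eqP => _.
  by rewrite (chain_iter_adj heg hu) prednK.
by have [->|i0] := posnP i; rewrite // (chain_iter heg hu) ?i0.
Qed.

(** The image of the basis under the reflection of [V0] that exchanges its first and last
    vectors. *)
Definition swap_ends e i :=
  if i == 0%N then e (2 * n)%N else if i == (2 * n)%N then e 0%N else e i.

Lemma swap_ends_form e i j : hyperbolic_family phi 1 (2 * n).+1 e ->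
  (i <= 2 * n)%N -> (j <= 2 * n)%N ->
  phi (swap_ends e i) (e j) = phi (e i) (swap_ends e j).
Proof.
move=> he i2n j2n; rewrite /swap_ends; do 2?case: eqP => [->|?]; do 2?case: eqP => [->|?];
  rewrite !he ?ltnS // !if_same; by do 2?case: eqP => ?; rewrite // ; lia.
Qed.

Lemma swap_ends_basis e g : osp_basis n phi psi e g ->
  osp_basis n phi psi (swap_ends e) g.
Proof.
move=> [he hg]; split=> // i j; rewrite !ltnS => i2n j2n.
rewrite /swap_ends; do 2?case: eqP => [->|?]; do 2?case: eqP => [->|?];
  rewrite !he ?ltnS // !if_same; by do 2?case: eqP => ?; rewrite // ; lia.
Qed.

Lemma swap_ends_sum e : swap_ends e 0%N + swap_ends e (2 * n)%N = e 0%N + e (2 * n)%N.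
Proof.
rewrite /swap_ends eqxx; case: eqP => [|_]; first by lia.
by rewrite eqxx addrC.
Qed.

Lemma swap_ends_tperm e (j : 'I_(2 * n).+1) :
  swap_ends e j = e (tperm ord0 ord_max j).
Proof.
rewrite /swap_ends permE /= -!val_eqE /=.
by case: eqP => // _; case: eqP.
Qed.

Lemma chain_family_swap e t i j : hyperbolic_family phi 1 (2 * n).+1 e ->
  (i <= 2 * n)%N -> (j <= 2 * n)%N ->
  phi (chain_family (swap_ends e) t i) (e j) = phi (chain_family e t i) (swap_ends e j).
Proof.
move=> he i2n j2n; rewrite /chain_family; case: eqP => _.
  by rewrite swap_ends_form //; lia.
case: eqP => _; first by rewrite !bformDl !swap_ends_form.
by rewrite !bformZl swap_ends_form.
Qed.

Section TwoBranches.
Variables (e : nat -> V0) (g : nat -> V1) (t : K) (u1 u2 : 'Hom(V0, V1)).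
Hypotheses (heg : osp_basis n phi psi e g).
Hypotheses (hu1 : chain_hom e g t u1) (hu2 : chain_hom (swap_ends e) g t u2).
Let v := e 0%N + e (2 * n)%N.
Let b := g 0%N.

(** The reflection is self-adjoint, so it passes from the family to the test vectors [e j], where it
    transposes the first and the last column. *)
Lemma chain_det_opp :
  orientation_det n phi psi v b e u2 = - orientation_det n phi psi v b e u1.
Proof.
have hse := swap_ends_basis heg; have [he _] := heg.
rewrite /orientation_det; set M2 := \matrix_(i, j) _; set M1 := \matrix_(i, j) _.
have -> : M2 = xcol ord0 ord_max M1.
  apply/matrixP => i j; rewrite !mxE (chain_orientation_family heg hu1) //; last exact: leq_ord.
  rewrite /v -swap_ends_sum (chain_orientation_family hse hu2); last exact: leq_ord.
  by rewrite chain_family_swap ?leq_ord // swap_ends_tperm.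
rewrite xcolE det_mulmx det_perm odd_tperm.
rewrite (_ : ord0 != ord_max) ?expr1 ?mulrN1 // -val_eqE /=.
by apply/eqP; lia.
Qed.

Lemma chain_denom : orientation_denom n phi psi v u1 = (\prod_(i < 2 * n) chain_coef t i) ^+ n.
Proof.
have [he _] := heg.
rewrite /orientation_denom (chain_iter heg hu1) ?muln_gt0 ?n0 ?leqnn //.
rewrite bformZr bformDl !he // add0n eqxx leq0n ifN ?addr0 ?mulr1 //.
by apply/eqP; lia.
Qed.

Lemma chain_denom_neq0 : t != 0 -> orientation_denom n phi psi v u1 != 0.
Proof.
move=> t0; rewrite chain_denom expf_neq0 //; apply/prodf_neq0 => i _.
rewrite /chain_coef !mulf_neq0 //; case: ifP => _ //; rewrite ?oner_eq0 //.
by rewrite oppr_eq0 oner_eq0.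
Qed.

Lemma chain_square_neq0 : orientation_square n phi psi v b u1 != 0.
Proof.
have [he _] := heg.
rewrite mulf_neq0 //; first by apply/prodf_neq0 => i _; rewrite signr_eq0.
rewrite (chain_orientation_family heg hu1); last by lia.
rewrite /chain_family eqxx he; try lia.
by rewrite leqnn ifT ?oner_eq0 //; lia.
Qed.

End TwoBranches.

Theorem odd_nilcone_not_normal : ~ normal_variety (odd_nilcone phi psi).
Proof.
have [e [g heg]] := exists_osp_basis osp; have [he _] := heg.
have hse := swap_ends_basis heg; have [he' _] := hse.
have ext e' := @hom_of_family _ _ phi 1 (mulr1 1) _ e' (osp_dim0 osp).
(* [x] is [u_0]; the directions [w1] and [w2] send [e 0], respectively [e (2 * n)], to [g 0] and
   kill the other basis vectors. *)
have [x hx] := ext e he _ (fun i => if i == 0%N then 0 else if (i < 2 * n)%N then g i else 0).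
have [w1 hw1] := ext e he _ (fun i => if i == 0%N then g 0%N else 0).
have [w2 hw2] := ext _ he' _ (fun i => if i == 0%N then g 0%N else 0).
have hu1 t : chain_hom e g t (x + t *: w1).
  move=> i i2n; rewrite add_lfunE scale_lfunE hx // hw1 //.
  by case: eqP => _; rewrite ?add0r ?scaler0 ?addr0.
(* Both ends of the basis are killed by [x], so exchanging them does not change its description. *)
have hx' i : (i <= 2 * n)%N -> x (swap_ends e i) =
    if i == 0%N then 0 else if (i < 2 * n)%N then g i else 0.
  move=> i2n; rewrite /swap_ends; case: eqP => [_|i0].
    by rewrite hx // ltnn if_same.
  by case: eqP => [->|_]; rewrite hx //= ?ltnn //; case: eqP.
have hu2 t : chain_hom (swap_ends e) g t (x + t *: w2).
  move=> i i2n; rewrite add_lfunE scale_lfunE hx' // hw2 //.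
  by case: eqP => _; rewrite ?add0r ?scaler0 ?addr0.
pose v := e 0%N + e (2 * n)%N; pose b := g 0%N.
apply: (@not_normal_of_branches _ _ _ x w1 w2 (orientation_denom n phi psi v)
  (orientation_det n phi psi v b e) (orientation_square n phi psi v b)).
- exact: polyfun_orientation_denom.
- exact: polyfun_orientation_det.
- exact: polyfun_orientation_square he.
- by move=> t; apply: chain_nilcone heg (hu1 t).
- by move=> t; apply: chain_nilcone hse (hu2 t).
- by move=> z; apply: orientation_det_sqr.
- by move=> t t0; apply: chain_denom_neq0 heg (hu1 t) t0.
- move=> t t0; split; last exact: (chain_det_opp heg (hu1 t) (hu2 t)).
  by rewrite (chain_denom heg (hu1 t)) /v -swap_ends_sum (chain_denom hse (hu2 t)).
- have := chain_square_neq0 heg (hu1 0); by rewrite scale0r addr0.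
Qed.

End Branches.

(** * Irreducible components *)

Section Irreducible.
Variable T : topologicalType.
Implicit Types A B C Z F S : set T.

(** Zorn's lemma is applied to the sets whose union with [S] is irreducible and contained in [Z];
    adjoining [S] takes care of the empty chain. *)
Lemma irreducible_component_sup Z S : irreducible S -> S `<=` Z ->
  exists2 A, irreducible_component Z A & S `<=` A.
Proof.
move=> irrS SZ.
pose P B := irreducible (B `|` S) /\ B `|` S `<=` Z.
have [X XP Xtot|A [[irrA AZ] Amax]] := @Zorn_bigcup _ P.
  split; last first.
    by move=> x [[B XB Bx]|/SZ//]; apply: (XP _ XB).2; left.
  split; first by have [[x Sx] _] := irrS; exists x; right.
  move=> F G cF cG UFG; apply: contrapT => /not_orP[/existsNP[x /not_implyP[Ux nFx]]].
  move=> /existsNP[y /not_implyP[Uy nGy]].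
  (* A point outside [F] and a point outside [G] lie, by totality of the chain, in one irreducible
     subset of the union. *)
  suff [B [irrB BU Bx By]] : exists B, [/\ irreducible B,
      B `<=` (\bigcup_(X0 in X) X0) `|` S, B x & B y].
    have [_ /(_ F G cF cG)] := irrB; case; first by move=> z /BU /UFG.
      by move/(_ _ Bx).
    by move/(_ _ By).
  have sub B : X B -> B `|` S `<=` (\bigcup_(X0 in X) X0) `|` S.
    by move=> XB z [Bz|Sz]; [left; exists B|right].
  case: Ux Uy => [[B XB Bx]|Sx] [[C XC Cy]|Sy].
  - have [BC|CB] := Xtot _ _ XB XC.
      by exists (C `|` S); split; [exact: (XP _ XC).1|exact: sub|left; exact: BC|left].
    by exists (B `|` S); split; [exact: (XP _ XB).1|exact: sub|left|left; exact: CB].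
  - by exists (B `|` S); split; [exact: (XP _ XB).1|exact: sub|left|right].
  - by exists (C `|` S); split; [exact: (XP _ XC).1|exact: sub|right|left].
  - by exists S; split=> // z; right.
exists (A `|` S); last by move=> x; right.
split=> // B irrB AB BZ; apply/seteqP; split=> // x Bx; left.
have BS : B `|` S = B by apply/seteqP; split=> y; [case=> // Sy; apply: AB; right|left].
have [[E]|nAB] := pselect (A = B); first by rewrite E.
have AB' : A `<=` B by move=> y Ay; apply: AB; left.
exfalso; apply: (Amax B); last by rewrite /P BS.
by split=> // BA; apply: nAB; apply/seteqP; split.
Qed.

Lemma irreducible_closure A Z : irreducible A -> A `<=` Z ->
  irreducible (Z `&` closure A).
Proof.
move=> [[x Ax] irrA] AZ; split.
  by exists x; split; [exact: AZ|exact: subset_closure].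
move=> F G cF cG sub.
have ZA F' : closed F' -> A `<=` F' -> Z `&` closure A `<=` F'.
  by move=> cF' AF' z [_ /(closure_subset AF')]; rewrite -(closure_id _).1.
have sub' : A `<=` F `|` G.
  by move=> z Az; apply: sub; split; [exact: AZ|exact: subset_closure].
by have [AF|AG] := irrA F G cF cG sub'; [left; apply: ZA | right; apply: ZA].
Qed.

(** In the induction [F0] absorbs the members of the finite union one at a time. *)
Lemma irreducible_sub_big A (I : eqType) (s : seq I) (F0 : set T) (F : I -> set T) :
    irreducible A -> closed F0 -> (forall i, closed (F i)) ->
    A `<=` F0 `|` [set x | exists2 i, i \in s & F i x] ->
  A `<=` F0 \/ exists i, A `<=` F i.
Proof.
move=> [A0 irrA] cF0 cF; elim: s F0 cF0 => [|i s IH] F0 cF0 sub.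
  by left=> x /sub[//|[]].
have [||h|] := IH (F0 `|` F i); first exact: closedU.
- move=> x /sub[h|[j]]; first by left; left.
  by rewrite inE => /orP[/eqP->|js] Fj; [left; right|right; exists j].
- by case: (irrA _ _ cF0 (cF i) h); [left|right; exists i].
- by right.
Qed.

(** Chains can be truncated: a common dimension at least [d] would give [B] a chain of length [d],
    and a smaller one is exceeded by the chain of [A]. *)
Lemma not_equidimensional_of_chains Z A B c d :
    irreducible_component Z A -> irreducible_component Z B ->
    irreducible_chain A d c -> ~ (exists c', irreducible_chain B d c') ->
  ~ equidimensional Z.
Proof.
move=> cA cB chA nB [k dimk]; have [_ nA] := dimk _ cA; have [[c' chB] _] := dimk _ cB.
have trunc A' k1 k2 c1 : (k1 <= k2)%N -> irreducible_chain A' k2 c1 -> irreducible_chain A' k1 c1.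
  move=> k12 [h1 h2]; split=> i hi; first exact/h1/(leq_trans hi).
  exact/h2/(leq_trans hi).
case: (leqP d k) => h; first by apply: nB; exists c'; apply: trunc chB.
by apply: nA; exists c; apply: trunc chA.
Qed.

End Irreducible.

(** * Flags and frames *)

Section FlagFrames.
Variables (K : fieldType) (n : nat) (V : vectType K).
Implicit Types (E : flag n V) (P : {ffun 'I_n -> V}).

Lemma flag_dim E i : \dim (E i) = i.
Proof. by have /andP[/forallP/(_ i)/eqP] := flagP E. Qed.

Lemma flag_sub E (i j : 'I_n.+1) : (i <= j)%N -> (E i <= E j)%VS.
Proof. by have /andP[_ /forallP/(_ i)/forallP/(_ j)/implyP] := flagP E. Qed.

Lemma flag_inj E E' : (forall i, E i <= E' i)%VS -> E = E'.
Proof.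
move=> EE'; apply: val_inj; apply/ffunP => i; apply/eqP.
by rewrite eqEdim EE' !flag_dim /=.
Qed.

Lemma frame_mem P E (j : 'I_n) (i : 'I_n.+1) : frame P E -> (j < i)%N -> P j \in E i.
Proof. by move=> PE ji; rewrite PE memvE (sumv_sup j). Qed.

Lemma frame_sub P E (i : 'I_n.+1) (U : {vspace V}) : frame P E ->
  reflect (forall j : 'I_n, (j < i)%N -> P j \in U) (E i <= U)%VS.
Proof.
move=> PE; rewrite PE; apply: (iffP subv_sumP) => H j ji.
  by rewrite memvE H.
by rewrite -memvE H.
Qed.

Lemma frame_inj P E E' : frame P E -> (forall i : 'I_n, P i \in E' (lift ord0 i)) -> E = E'.
Proof.
move=> PE H; apply: flag_inj => i; apply/(frame_sub _ _ PE) => j ji.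
by apply: (subvP (flag_sub _ _)) (H j); rewrite /= /bump leq0n.
Qed.

Lemma exists_frame E : exists P, frame P E.
Proof.
(* [lift ord0 j] is the index [j.+1] and [widen_ord _ j] the index [j]: one new vector is picked at
   each step of the flag. *)
have /boolp.choice[p hp] (j : 'I_n) : exists v,
    v \in E (lift ord0 j) /\ v \notin E (widen_ord (leqnSn n) j).
  have /subvPn[v h1 h2] : ~~ (E (lift ord0 j) <= E (widen_ord (leqnSn n) j))%VS.
    by apply/negP => /dimvS; rewrite !flag_dim /= /bump leq0n add1n ltnn.
  by exists v.
exists [ffun j => p j] => -[m].
elim: m => [|i IH] im.
  by apply/eqP; rewrite big_pred0 // -dimv_eq0 flag_dim.
have im' : (i < n.+1)%N by apply: ltnW.
have Ei := IH im'; pose j := Ordinal (im : (i < n)%N).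
have Ej : E (Ordinal im') = E (widen_ord (leqnSn n) j) by congr (E _); apply: val_inj.
have Ej' : E (Ordinal im) = E (lift ord0 j) by congr (E _); apply: val_inj.
have [h1 h2] := hp j.
have -> : (\sum_(j0 < n | (j0 < Ordinal im)%N) <[[ffun j => p j] j0]> =
           <[p j]> + E (Ordinal im'))%VS.
  rewrite Ei (bigD1 j) //= ffunE; congr (_ + _)%VS; apply: eq_bigl => k.
  by rewrite -val_eqE /= ltnS ltn_neqAle andbC.
apply/eqP; rewrite eq_sym eqEdim subv_add -memvE Ej' h1 flag_sub ?leqnSn //=.
rewrite flag_dim dimv_disjoint_sum ?flag_dim; last first.
  apply/eqP; rewrite -subv0; apply/subvP => v /memv_capP[/vlineP[k ->] kE].
  have [->|k0] := eqVneq k 0; first by rewrite scale0r mem0v.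
  by case/negP: h2; rewrite -Ej -(scalerK k0 (p j)) rpredZ.
rewrite dim_vline; have -> : p j != 0 by apply: contraNneq h2 => ->; rewrite mem0v.
by rewrite /= /bump leq0n.
Qed.

Lemma exists_flag P : free [seq P i | i <- enum 'I_n] -> exists E, frame P E.
Proof.
move=> freeP.
pose U (i : 'I_n.+1) : {vspace V} := (\sum_(j < n | (j < i)%N) <[P j]>)%VS.
pose s (i : 'I_n.+1) := [seq P j | j : 'I_n <- enum 'I_n & (j < i)%N].
have dimU i : \dim (U i) = i.
  have -> : U i = <<s i>>%VS.
    by rewrite span_def big_map big_filter big_enum_cond; apply: eq_bigl => j; rewrite ?andbT ?andTb.
  have /eqP -> : free (s i).
    apply: (@catl_free _ _ [seq P j | j : 'I_n <- enum 'I_n & ~~ (j < i)%N]).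
    rewrite -map_cat (perm_free (_ : perm_eq _ [seq P i | i <- enum 'I_n])) //.
    by rewrite perm_map // perm_filterC.
  rewrite size_map size_filter -[RHS](card_ord i) -sum1_card.
  have le : (i <= n)%N by rewrite -ltnS.
  rewrite -sum1_count big_enum_cond /= (big_ord_widen_cond _ predT (fun=> 1%N) le).
  by apply: eq_bigl => j; rewrite ?andbT ?andTb.
have isf : is_flag [ffun i => U i].
  apply/andP; split; apply/forallP => i; first by rewrite ffunE dimU.
  apply/forallP => j; apply/implyP => ij; rewrite !ffunE.
  by apply/subv_sumP => k ki; rewrite (sumv_sup k) // (leq_trans ki).
by exists (Flag isf) => i; rewrite /= ffunE.
Qed.

End FlagFrames.

(** * Constructions of polynomial curves, up to curves of frames *)

Section PolynomialCurvesConstr.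
Variables (K : numFieldType).

Lemma polycurve_cst (W : vectType K) (w : W) : polycurve (fun=> w).
Proof. by move=> l _; exists (l w)%:P => t; rewrite hornerC. Qed.

Lemma polycurve_scale (W : vectType K) (q : {poly K}) (w : W) :
  polycurve (fun t => q.[t] *: w).
Proof.
move=> l hl; exists (l w *: q) => t; rewrite hornerZ mulrC.
have l0 : l 0 = 0 by have := @scalar_sum _ _ l nat [::] (fun=> 0) (fun=> 0) hl; rewrite !big_nil.
by have := hl q.[t] w 0; rewrite addr0 l0 addr0.
Qed.

Lemma polycurveD (W : vectType K) (c d : K -> W) :
  polycurve c -> polycurve d -> polycurve (fun t => c t + d t).
Proof.
move=> hc hd l hl; have [p hp] := hc l hl; have [q hq] := hd l hl.
exists (p + q) => t; rewrite hornerD -hp -hq.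
by have := hl 1 (c t) (d t); rewrite scale1r mul1r.
Qed.

Lemma polycurve_linear (W W' : vectType K) (f : W -> W') (c : K -> W) :
  linear f -> polycurve c -> polycurve (fun t => f (c t)).
Proof. by move=> hf hc l hl; apply: (hc (l \o f)) => a x y /=; rewrite hf hl. Qed.

Lemma polycurve_sum (W : vectType K) n (F : 'I_n -> K -> W) :
  (forall i, polycurve (F i)) -> polycurve (fun t => \sum_i F i t).
Proof.
move=> hF; suff h (s : seq 'I_n) : polycurve (fun t => \sum_(i <- s) F i t) by exact: h.
elim: s => [|i s IH] l hl.
  by have [q hq] := polycurve_cst 0 hl; exists q => t; rewrite big_nil (hq t).
by have [q hq] := polycurveD (hF i) IH hl; exists q => t; rewrite big_cons (hq t).
Qed.

Lemma polycurve_ffun n (V : vectType K) (P : 'I_n -> K -> V) :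
  (forall i, polycurve (P i)) -> polycurve (fun t => [ffun i => P i t]).
Proof.
move=> hP l hl.
pose delta (i : 'I_n) (x : V) : {ffun 'I_n -> V} := [ffun j => if j == i then x else 0].
have lin i : linear (delta i).
  by move=> a x y; apply/ffunP => j; rewrite !ffunE; case: eqP => _; rewrite ?scaler0 ?addr0.
have [q hq] := polycurve_sum (fun i => polycurve_linear (lin i) (hP i)) hl.
exists q => t; rewrite -hq; congr (l _); apply/ffunP => j.
rewrite sum_ffunE ffunE (bigD1 j) //= ffunE eqxx big1 ?addr0 // => i ij.
by rewrite ffunE eq_sym (negbTE ij).
Qed.

Lemma polycurve_frames n (V0 V1 : vectType K) (u : 'Hom(V0, V1))
    (P : 'I_n -> K -> V0) (Q : 'I_n -> K -> V1) :
    (forall i, polycurve (P i)) -> (forall i, polycurve (Q i)) ->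
  polycurve (fun t => (u, [ffun i => P i t], [ffun i => Q i t]) : frame_pairs n V0 V1).
Proof.
move=> hP hQ l hl.
have ext (z z' : frame_pairs n V0 V1) :
    z.1.1 = z'.1.1 -> z.1.2 = z'.1.2 -> z.2 = z'.2 -> z = z'.
  by case: z z' => [[? ?] ?] [[? ?] ?] /= -> -> ->.
have lin0 : linear (fun x : {ffun 'I_n -> V0} => (0, x, 0) : frame_pairs n V0 V1).
  by move=> a x y; apply: ext => /=; rewrite ?scaler0 ?addr0.
have lin1 : linear (fun x : {ffun 'I_n -> V1} => (0, 0, x) : frame_pairs n V0 V1).
  by move=> a x y; apply: ext => /=; rewrite ?scaler0 ?addr0.
have [q hq] := polycurveD (polycurve_cst ((u, 0, 0) : frame_pairs n V0 V1))
  (polycurveD (polycurve_linear lin0 (polycurve_ffun hP))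
              (polycurve_linear lin1 (polycurve_ffun hQ))) hl.
exists q => t; rewrite -hq; congr (l _).
by apply: ext => /=; rewrite ?addr0 ?add0r.
Qed.

End PolynomialCurvesConstr.

(** * Closed and irreducible sets of pairs of flags *)

Section FlagTopology.
Variables (K : numFieldType) (n : nat) (V0 V1 : vectType K).
Local Notation T := (flag_pairs n V0 V1).
Local Notation W := (frame_pairs n V0 V1).

Lemma closed_of_polyfun (A : set T) (S : set (W -> K)) :
    (forall f, S f -> polyfun f) ->
    (forall u P Q E F, frame P E -> frame Q F ->
       A (u, E, F) <-> forall f, S f -> f (u, P, Q) = 0) ->
  closed A.
Proof.
move=> polyS hA; apply/closed_flag_pairsE.
exists [set p | S (@peval K W p)] => u P Q E F hP hQ.
rewrite (hA _ _ _ _ _ hP hQ); split=> [H p Sp|H f Sf]; first exact: H.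
have [p hp] := polyS _ Sf.
have fE : @peval K W p = f by apply/funext.
by rewrite -hp; apply: H; rewrite /= fE.
Qed.

Lemma polyfun_frame0 (l : V0 -> K) j : scalar l -> polyfun (fun w : W => l (w.1.2 j)).
Proof. by move=> hl; apply: polyfun_scalar => a x y; rewrite /= !ffunE hl. Qed.

Lemma polyfun_frame1 (l : V1 -> K) j : scalar l -> polyfun (fun w : W => l (w.2 j)).
Proof. by move=> hl; apply: polyfun_scalar => a x y; rewrite /= !ffunE hl. Qed.

(** These are linear equations for [U], obtained from a projection onto it. *)
Lemma mem_coord_projv (V : vectType K) (U : {vspace V}) v :
  v \in U <-> forall k, coord (vbasis {:V}) k (v - projv U v) = 0.
Proof.
split=> [vU k|H]; first by rewrite projv_id // subrr linear0.
have : v - projv U v = 0.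
  by rewrite (coord_vbasis (memvf (v - projv U v))) big1 // => k _; rewrite H scale0r.
by move/eqP; rewrite subr_eq0 => /eqP->; apply: memv_proj.
Qed.

Lemma coord_projv_scalar (V : vectType K) (U : {vspace V}) k :
  scalar (fun v => coord (vbasis {:V}) k (v - projv U v)).
Proof. by move=> a x y; rewrite linearP opprD addrACA -scalerBr linearP. Qed.

Lemma closed_flag_sub0 (i : 'I_n.+1) (U : {vspace V0}) :
  closed [set z : T | (z.1.2 i <= U)%VS].
Proof.
pose S : set (W -> K) := [set f | exists (j : 'I_n) k, (j < i)%N /\
  f = fun w : W => coord (vbasis {:V0}) k (w.1.2 j - projv U (w.1.2 j))].
apply: (@closed_of_polyfun _ S).
  by move=> _ [j [k [_ ->]]]; apply: polyfun_frame0 (coord_projv_scalar U k).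
move=> u P Q E F hP hQ /=; split=> [/(frame_sub _ _ hP) EU _ [j [k [ji ->]]] /=|H].
  by move: k; apply/mem_coord_projv/EU.
by apply/(frame_sub _ _ hP) => j ji; apply/mem_coord_projv => k;
  have := H _ (ex_intro _ j (ex_intro _ k (conj ji erefl))).
Qed.

Lemma closed_flag_sub1 (i : 'I_n.+1) (U : {vspace V1}) :
  closed [set z : T | (z.2 i <= U)%VS].
Proof.
pose S : set (W -> K) := [set f | exists (j : 'I_n) k, (j < i)%N /\
  f = fun w : W => coord (vbasis {:V1}) k (w.2 j - projv U (w.2 j))].
apply: (@closed_of_polyfun _ S).
  by move=> _ [j [k [_ ->]]]; apply: polyfun_frame1 (coord_projv_scalar U k).
move=> u P Q E F hP hQ /=; split=> [/(frame_sub _ _ hQ) EU _ [j [k [ji ->]]] /=|H].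
  by move: k; apply/mem_coord_projv/EU.
by apply/(frame_sub _ _ hQ) => j ji; apply/mem_coord_projv => k;
  have := H _ (ex_intro _ j (ex_intro _ k (conj ji erefl))).
Qed.

(** By bilinearity it suffices to test the vectors of the two frames, and there the condition is
    polynomial. *)
Lemma closed_flag_bilinear (i k : 'I_n.+1) (b : V0 -> V1 -> K) :
    (forall x, scalar (b x)) -> (forall y, scalar (b^~ y)) ->
  closed [set z : T | forall x y, x \in z.1.2 i -> y \in z.2 k -> b x y = 0].
Proof.
move=> bl br.
pose S : set (W -> K) := [set f | exists (j l : 'I_n), [/\ (j < i)%N, (l < k)%N &
  f = fun w : W => b (w.1.2 j) (w.2 l)]].
apply: (@closed_of_polyfun _ S).
  move=> _ [j [l [_ _ ->]]].
  pose v := vbasis {:V0}.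
  apply: (@polyfun_ext _ _ (fun w : W => \sum_m coord v m (w.1.2 j) * b v`_m (w.2 l))).
    move=> w; rewrite [in RHS](coord_vbasis (memvf (w.1.2 j))).
    by rewrite (scalar_sum _ _ _ (br (w.2 l))).
  apply: polyfun_sum => m; apply: polyfunM.
    exact: polyfun_frame0 (coord_scalar v m).
  exact: polyfun_frame1 (bl v`_m).
move=> u P Q E F hP hQ /=; split=> [H _ [j [l [ji lk ->]]] /=|H x y].
  by apply: H; apply: frame_mem; eassumption.
rewrite hP hQ => /memv_sumP[x' hx' ->] /memv_sumP[y' hy' ->].
have sum0 (V : vectType K) (h : V -> K) (s : pred 'I_n) (z : 'I_n -> V) : scalar h ->
    (forall m, s m -> h (z m) = 0) -> h (\sum_(m < n | s m) z m) = 0.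
  move=> hh hz; have := scalar_sum (index_enum 'I_n) (fun m => (s m)%:R) z hh.
  rewrite (eq_bigr (fun m => if s m then z m else 0)) => [|m _]; last first.
    by case: (s m); rewrite ?scale1r ?scale0r.
  rewrite -big_mkcond => ->; apply: big1 => m _.
  by case sm: (s m); [rewrite hz ?mulr0|rewrite mul0r].
apply: (sum0 _ (b^~ _)) => // m mi; apply: sum0 => // l lk.
have /vlineP[c ->] := hx' _ mi; have /vlineP[d ->] := hy' _ lk.
have zl (V : vectType K) (h : V -> K) e z : scalar h -> h (e *: z) = e * h z.
  move=> hh; have := scalar_sum [:: tt] (fun=> e) (fun=> z) hh.
  by rewrite !big_seq1.
rewrite (zl _ _ _ _ (br _)) (zl _ _ _ _ (bl _)).
have -> : b (P m) (Q l) = 0.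
  exact: (H _ (ex_intro _ m (ex_intro _ l (And3 mi lk erefl)))).
by rewrite !mulr0.
Qed.

(* Irreducibility is tested on the rational curves joining two given points. *)
Lemma irreducible_of_curves (A : set T) : A !=set0 ->
    (forall z1 z2, A z1 -> A z2 -> exists (z : K -> T) (P : K -> {ffun 'I_n -> V0})
       (Q : K -> {ffun 'I_n -> V1}),
      [/\ forall t, A (z t) /\ frame (P t) (z t).1.2 /\ frame (Q t) (z t).2,
          polycurve (fun t => ((z t).1.1, P t, Q t) : W), z 0 = z1 & z 1 = z2]) ->
  irreducible A.
Proof.
move=> A0 curves; split=> // F G /closed_flag_pairsE[S hS] /closed_flag_pairsE[S' hS'] AFG.
apply: contrapT => /not_orP[/existsNP[z1 /not_implyP[Az1 nF]]].
move=> /existsNP[z2 /not_implyP[Az2 nG]].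
have [z [P [Q [hz cz z_0 z_1]]]] := curves _ _ Az1 Az2.
have memE (B : set T) S0 t :
    (forall u P Q (E : flag n V0) (F : flag n V1), frame P E -> frame Q F ->
    B (u, E, F) <-> (forall p, S0 p -> @peval K W p (u, P, Q) = 0)) ->
    B (z t) <-> (forall p, S0 p -> @peval K W p ((z t).1.1, P t, Q t) = 0).
  have [_ [hP hQ]] := hz t; move: hP hQ; case: (z t) => [[u E] F'] /= hP hQ hB.
  exact: hB.
(* A closed set that misses one point of the curve meets it only at roots of a nonzero
   polynomial. *)
have pick (B : set T) S0 t :
    (forall u P Q (E : flag n V0) (F : flag n V1), frame P E -> frame Q F ->
    B (u, E, F) <-> (forall p, S0 p -> @peval K W p (u, P, Q) = 0)) -> ~ B (z t) ->
    exists q : {poly K}, q != 0 /\ forall s, B (z s) -> q.[s] = 0.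
  move=> hB nB; have /existsNP[p /not_implyP[Sp pt]] :
      ~ (forall p, S0 p -> @peval K W p ((z t).1.1, P t, Q t) = 0).
    by move=> H; apply: nB; apply/(memE _ _ _ hB).
  have [q hq] := peval_polycurve p cz; exists q; split.
    by apply/eqP => q0; apply: pt; rewrite hq q0 horner0.
  by move=> s /(memE _ _ _ hB)/(_ _ Sp); rewrite hq.
have [|q [q0 hq]] := pick F S 0 hS; first by rewrite z_0.
have [|r [r0 hr]] := pick G S' 1 hS'; first by rewrite z_1.
(* Since [F] and [G] cover the curve, every parameter is a root of [q] or of [r]. *)
suff : q * r = 0 by move/eqP; rewrite mulf_eq0 (negbTE q0) (negbTE r0).
apply: polynomial_punctured_eq0 => t _; rewrite hornerM.
by case: (AFG _ (hz t).1) => [/hq->|/hr->]; rewrite ?mul0r ?mulr0.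
Qed.

End FlagTopology.

(** * Springer fibers in terms of frames *)

Section SpringerFrames.
Variables (K : numFieldType) (V0 V1 : vectType K) (n : nat).
Variables (phi : 'Hom(V0, dual V0)) (psi : 'Hom(V1, dual V1)).

Lemma isotropic_frame (V : vectType K) (b : 'Hom(V, dual V)) P (E : flag n V) :
  frame P E -> (forall i, isotropic b (E i)) <-> (forall j k, b (P j) (P k) = 0).
Proof.
move=> PE; split=> [H j k|H i x y].
  by apply: (H ord_max); apply: frame_mem PE _; apply: ltn_ord.
rewrite PE => /memv_sumP[x' hx' ->] /memv_sumP[y' hy' ->].
have /boolp.choice[c hc] (j : 'I_n) : exists c, (j < i)%N -> x' j = c *: P j.
  case: (boolP (j < i)%N) => [ji|_]; last by exists 0.
  by have /vlineP[c ->] := hx' _ ji; exists c.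
have /boolp.choice[d hd] (j : 'I_n) : exists c, (j < i)%N -> y' j = c *: P j.
  case: (boolP (j < i)%N) => [ji|_]; last by exists 0.
  by have /vlineP[c' ->] := hy' _ ji; exists c'.
rewrite (eq_bigr _ hc) (eq_bigr _ hd).
rewrite -big_filter bform_suml big1 // => j _.
by rewrite -big_filter bform_sumr big1 ?mulr0 // => k _; rewrite H mulr0.
Qed.

(** As the flags increase, each frame vector need only be tested at the step where it first
    appears. *)
Lemma springer_fiber_frame (u : 'Hom(V0, V1)) P Q (E : flag n V0) (F : flag n V1) :
    frame P E -> frame Q F ->
  springer_fiber phi psi n u (u, E, F) <->
  [/\ forall j k, phi (P j) (P k) = 0, forall j k, psi (Q j) (Q k) = 0 &
      forall j : 'I_n, u (P j) \in F (widen_ord (leqnSn n) j) /\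
                       adj phi psi u (Q j) \in E (lift ord0 j)].
Proof.
move=> hP hQ; have isoP := isotropic_frame phi hP; have isoQ := isotropic_frame psi hQ.
have mem0 (j i : 'I_n) : (j <= i)%N -> P j \in E (lift ord0 i).
  by move=> ji; apply: frame_mem hP _; rewrite /= /bump leq0n.
have mem1 (j i : 'I_n) : (j <= i)%N -> Q j \in F (lift ord0 i).
  by move=> ji; apply: frame_mem hQ _; rewrite /= /bump leq0n.
split=> [[[h1 h2 h3] _]|[h1 h2 h3]].
  split; [exact/isoP|exact/isoQ|] => j; have [/subvP a1 /subvP a2] := h3 j.
  by split; [apply: a1|apply: a2]; apply: memv_img; [apply: mem0|apply: mem1].
split=> //; split; [exact/isoP|exact/isoQ|] => i; split; apply/subvP => _ /memv_imgP[x xE ->].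
  have : (E (lift ord0 i) <= u @^-1: F (widen_ord (leqnSn n) i))%VS.
    apply/(frame_sub _ _ hP) => j; rewrite /= /bump leq0n ltnS => ji.
    rewrite -memv_preim; apply: (subvP (flag_sub _ _)) (h3 j).1 => //.
  by move/subvP/(_ _ xE); rewrite -memv_preim.
have : (F (lift ord0 i) <= adj phi psi u @^-1: E (lift ord0 i))%VS.
  apply/(frame_sub _ _ hQ) => j; rewrite /= /bump leq0n ltnS => ji.
  rewrite -memv_preim; apply: (subvP (flag_sub _ _)) (h3 j).2 => //.
by move/subvP/(_ _ xE); rewrite -memv_preim.
Qed.

End SpringerFrames.

(** * A fiber with two points *)

Section Disconnected.
Variables (K : numClosedFieldType) (V0 V1 : vectType K).
Variables (phi : 'Hom(V0, dual V0)) (psi : 'Hom(V1, dual V1)).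
Hypothesis osp : osp_form phi psi 1.

Lemma frame_lift0 (V : vectType K) (P : {ffun 'I_1 -> V}) (E : flag 1 V) :
  frame P E -> E (lift ord0 ord0) = <[P ord0]>%VS.
Proof. by move=> ->; rewrite big_mkcond big_ord1. Qed.

Lemma flag_widen0 (V : vectType K) n (E : flag n.+1 V) v :
  v \in E (widen_ord (leqnSn n.+1) ord0) -> v = 0.
Proof.
have : \dim (E (widen_ord (leqnSn n.+1) ord0)) == 0%N by rewrite flag_dim.
by rewrite dimv_eq0 => /eqP->; rewrite memv0 => /eqP.
Qed.

Lemma exists_flag1 (V : vectType K) (x : V) : x != 0 ->
  exists E : flag 1 V, frame [ffun=> x] E.
Proof. by move=> x0; apply: exists_flag; rewrite enum_ordSl enum_ord0 /= ffunE seq1_free. Qed.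

Theorem exists_disconnected_fiber :
  exists2 u : 'Hom(V0, V1), odd_nilcone phi psi u &
    ~ connected (springer_fiber phi psi 1 u).
Proof.
have [e [g heg]] := exists_osp_basis osp; have [he hg] := heg.
(* This is [u_0], whose kernel contains both isotropic lines [<e_0>] and [<e_2>]. *)
have [u hu0] := @hom_of_family _ _ phi 1 (mulr1 1) _ e (osp_dim0 osp) he V1
  (fun i => if i == 1%N then g 1%N else 0).
have hu : chain_hom 1 e g 0 u.
  by move=> i i2; rewrite hu0 //; case: i i2 => [|[|[|i]]] //=; rewrite scale0r.
exists u; first exact (chain_nilcone osp (ltn0Sn 0) heg hu).
have e00 : phi (e 0%N) (e 0%N) = 0 := he 0%N 0%N isT isT.
have e02 : phi (e 0%N) (e 2%N) = 1 := he 0%N 2%N isT isT.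
have e20 : phi (e 2%N) (e 0%N) = 1 := he 2%N 0%N isT isT.
have e22 : phi (e 2%N) (e 2%N) = 0 := he 2%N 2%N isT isT.
have e11 : phi (e 1%N) (e 1%N) = 1 := he 1%N 1%N isT isT.
have e01 : phi (e 0%N) (e 1%N) = 0 := he 0%N 1%N isT isT.
have e21 : phi (e 2%N) (e 1%N) = 0 := he 2%N 1%N isT isT.
have g01 : psi (g 0%N) (g 1%N) = 1 := hg 0%N 1%N isT isT.
have g11 : psi (g 1%N) (g 1%N) = 0 := hg 1%N 1%N isT isT.
have u0 : u (e 0%N) = 0 by rewrite hu0.
have u1 : u (e 1%N) = g 1%N by rewrite hu0.
have u2 : u (e 2%N) = 0 by rewrite hu0.
have a0 : adj phi psi u (g 0%N) = e 1%N.
  by rewrite (chain_adj osp isT heg hu) //= mulr1 scale1r.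
have a1 : adj phi psi u (g 1%N) = 0.
  by rewrite (chain_adj osp isT heg hu) //= mul0r scale0r.
have nz (V : vectType K) (b : 'Hom(V, dual V)) x y : b x y = 1 -> x != 0.
  by apply: contra_eq_neq => ->; rewrite bform0l eq_sym oner_eq0.
have g1nz : g 1%N != 0.
  apply: contra_eq_neq g01 => ->; by rewrite bform0r eq_sym oner_eq0.
pose i1 : 'I_2 := lift ord0 ord0.
pose Cl x := [set z : flag_pairs 1 V0 V1 | (z.1.2 i1 <= <[x]>)%VS].
have closedCl x : closed (Cl x) by apply: closed_flag_sub0.
have pt x : x != 0 -> phi x x = 0 -> u x = 0 ->
    exists z, springer_fiber phi psi 1 u z /\ Cl x z.
  move=> xnz xx ux; have [E hE] := exists_flag1 xnz; have [F hF] := exists_flag1 g1nz.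
  exists (u, E, F); split.
    apply/(springer_fiber_frame _ _ _ hE hF); split=> [j k|j k|j]; rewrite !ffunE //.
    by rewrite ux a1 !mem0v.
  by rewrite /Cl /= (frame_lift0 hE) ffunE subvv.
(* As [F_0 = 0], the map [u] kills [E_1], which removes the coordinate on [e 1]; by isotropy the
   product of the other two coordinates is 0. *)
have dich z : springer_fiber phi psi 1 u z -> Cl (e 0%N) z \/ Cl (e 2%N) z.
  case: z => [[u' E] F] fz; have u'E : u' = u by case: fz.
  rewrite {}u'E in fz *.
  have [P hP] := exists_frame E; have [Q hQ] := exists_frame F.
  have [/(_ ord0 ord0) pp _ /(_ ord0)[/flag_widen0 up]] :=
    (springer_fiber_frame phi psi u hP hQ).1 fz.
  rewrite /Cl /= (frame_lift0 hP) -!memvE.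
  have [c pE] := @family_expand _ _ phi 1 (mulr1 1) 3 e (osp_dim0 osp) he (P ord0).
  move=> _; move: pE up pp; rewrite !big_ord_recl big_ord0 /= addr0.
  move: (c _) (c _) (c _) => x y z -> up pp.
  have /eqP : y *: g 1%N = 0.
    by rewrite -up !linearD !linearZ /= u0 u1 u2 !scaler0 add0r addr0.
  rewrite scaler_eq0 (negbTE g1nz) orbF => /eqP y0.
  move: pp; rewrite y0 scale0r add0r.
  rewrite !bformE e00 e02 e20 e22 !mulr0 !mulr1 add0r addr0 => /eqP.
  rewrite (mulrC z) -mulr2n -mulr_natr mulf_eq0 pnatr_eq0 orbF mulf_eq0.
  by case/orP=> /eqP->; rewrite scale0r ?add0r ?addr0; [left|right];
    rewrite rpredZ ?memv_line.
have excl z : Cl (e 0%N) z -> ~ Cl (e 2%N) z.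
  rewrite /Cl /= => /subvP h0 /subvP h2.
  have : (z.1.2 i1 <= 0)%VS.
    apply/subvP => v vE; have /vlineP[a va] := h0 _ vE; have /vlineP[b vb] := h2 _ vE.
    have : phi v (e 2%N) = a by rewrite va bformE e02 mulr1.
    by rewrite vb bformE e22 mulr0 => a0'; rewrite -vb va -a0' scale0r mem0v.
  by rewrite subv0 -dimv_eq0 flag_dim.
(* The part of the fiber with [E_1 = <e_0>] is relatively closed, and relatively open as the
   complement of the part with [E_1 = <e_2>]; neither part is empty. *)
move=> conn; pose B := springer_fiber phi psi 1 u `&` Cl (e 0%N).
have [z0 [f0 c0]] := pt _ (nz _ _ _ _ e02) e00 u0.
have [z2 [f2 c2]] := pt _ (nz _ _ _ _ e20) e22 u2.
have BE : B = springer_fiber phi psi 1 u.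
  apply: conn; first by exists z0.
    exists (~` Cl (e 2%N)); first exact/closed_openC/closedCl.
    apply/seteqP; split=> z [fz]; first by move=> /excl.
    by case: (dich _ fz).
  by exists (Cl (e 0%N)).
by case: (excl z2) => //; move: f2; rewrite -BE => -[].
Qed.

End Disconnected.

(** * A fiber with components of dimensions 1 and 2 *)

Section FlagsOfLength2.
Variables (K : fieldType) (V : vectType K).

(** The indices have the shape [lift ord0 i] in which they occur in the conditions defining the
    fiber. *)
Definition ord2_1 : 'I_2 := lift ord0 ord0.
Definition ord3_1 : 'I_3 := lift ord0 ord0.
Definition ord3_2 : 'I_3 := lift ord0 ord2_1.

Definition pair_family (x y : V) : {ffun 'I_2 -> V} :=
  [ffun i => if i == ord0 then x else y].

Lemma ord2P (Q : 'I_2 -> Prop) : Q ord0 -> Q ord2_1 -> forall i, Q i.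
Proof.
move=> Q0 Q1 [[|[|//]] h].
  by rewrite (_ : Ordinal h = ord0) //; apply: val_inj.
by rewrite (_ : Ordinal h = ord2_1) //; apply: val_inj.
Qed.

Lemma pair_family0 x y : pair_family x y ord0 = x. Proof. by rewrite ffunE. Qed.

Lemma pair_family1 x y : pair_family x y ord2_1 = y. Proof. by rewrite ffunE. Qed.

Lemma frame2_1 P (E : flag 2 V) : frame P E -> E ord3_1 = <[P ord0]>%VS.
Proof. by move=> ->; rewrite big_mkcond !big_ord_recl big_ord0 /= !addv0. Qed.

Lemma frame2_w1 P (E : flag 2 V) :
  frame P E -> E (widen_ord (leqnSn 2) ord2_1) = <[P ord0]>%VS.
Proof. by move=> ->; rewrite big_mkcond !big_ord_recl big_ord0 /= !addv0. Qed.

Lemma frame2_2 P (E : flag 2 V) : frame P E -> E ord3_2 = (<[P ord0]> + <[P ord2_1]>)%VS.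
Proof. by move=> ->; rewrite big_mkcond !big_ord_recl big_ord0 /= !addv0. Qed.

Lemma mem_span2 (x y v : V) :
  v \in (<[x]> + <[y]>)%VS -> exists a b, v = a *: x + b *: y.
Proof. by move=> /memv_addP[_ /vlineP[a ->] [_ /vlineP[b ->] ->]]; exists a, b. Qed.

Lemma span2_mem (x y : V) a b : a *: x + b *: y \in (<[x]> + <[y]>)%VS.
Proof. by rewrite memv_add // rpredZ ?memv_line. Qed.

(** Pairing with [z] shows that [x] is not a multiple of [y], and pairing with [t] that [y] is
    nonzero. *)
Lemma exists_flag2 (b : 'Hom(V, dual V)) (x y z t : V) :
    b x z != 0 -> b y z = 0 -> b y t != 0 ->
  exists E : flag 2 V, frame (pair_family x y) E.
Proof.
move=> xz yz yt; apply: exists_flag.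
rewrite !enum_ordSl enum_ord0 /= !ffunE /= free_cons seq1_free span_seq1; apply/andP; split.
  by apply/vlineP => -[k kE]; move: xz; rewrite kE bformZl yz mulr0 eqxx.
by apply: contraNneq yt => ->; rewrite bform0l.
Qed.

End FlagsOfLength2.

Section NotEquidimensional.
Variables (K : numClosedFieldType) (V0 V1 : vectType K).
Variables (phi : 'Hom(V0, dual V0)) (psi : 'Hom(V1, dual V1)).
Hypothesis osp : osp_form phi psi 2.
Variables (e : nat -> V0) (g : nat -> V1) (u : 'Hom(V0, V1)).
Hypothesis heg : osp_basis 2 phi psi e g.
Hypothesis hu : forall i, (i < 5)%N -> u (e i) = if (i < 3)%N then g i else 0.

Let phi_table (i j : nat) : K := match i, j with
  | 0%N, 4%N | 1%N, 3%N | 2%N, 2%N | 3%N, 1%N | 4%N, 0%N => 1 | _, _ => 0 end.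
Let psi_table (i j : nat) : K := match i, j with
  | 0%N, 3%N | 1%N, 2%N => 1 | 2%N, 1%N | 3%N, 0%N => -1 | _, _ => 0 end.

Let phiE i j : (i < 5)%N -> (j < 5)%N -> phi (e i) (e j) = phi_table i j.
Proof.
move=> hi hj; rewrite heg.1 //.
by do 5?[case: i hi => [|i] hi //]; do 5?[case: j hj => [|j] hj //].
Qed.

Let psiE i j : (i < 4)%N -> (j < 4)%N -> psi (g i) (g j) = psi_table i j.
Proof.
move=> hi hj; rewrite heg.2 //.
by do 4?[case: i hi => [|i] hi //]; do 4?[case: j hj => [|j] hj //].
Qed.

Let phi_expand p : exists x0 x1 x2 x3 x4,
  p = x0 *: e 0%N + x1 *: e 1%N + x2 *: e 2%N + x3 *: e 3%N + x4 *: e 4%N.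
Proof.
have [c ->] := @family_expand _ _ phi 1 (mulr1 1) 5 e (osp_dim0 osp) heg.1 p.
rewrite !big_ord_recl big_ord0 /= addr0 !addrA.
by do 5!eexists.
Qed.

Let psi_expand q : exists y0 y1 y2 y3,
  q = y0 *: g 0%N + y1 *: g 1%N + y2 *: g 2%N + y3 *: g 3%N.
Proof.
have m1 : (-1) * (-1) = 1 :> K by rewrite mulrNN mulr1.
have [c ->] := @family_expand _ _ psi (-1) m1 4 g (osp_dim1 osp) heg.2 q.
rewrite !big_ord_recl big_ord0 /= addr0 !addrA.
by do 4!eexists.
Qed.

Let uE x0 x1 x2 x3 x4 :
  u (x0 *: e 0%N + x1 *: e 1%N + x2 *: e 2%N + x3 *: e 3%N + x4 *: e 4%N) =
  x0 *: g 0%N + x1 *: g 1%N + x2 *: g 2%N.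
Proof. by rewrite !linearD !linearZ /= !hu //= !scaler0 !addr0. Qed.

Let adj_table (i : nat) : V0 := match i with
  | 1%N => e 2%N | 2%N => - e 3%N | 3%N => - e 4%N | _ => 0 end.

Let adjE i : (i < 4)%N -> adj phi psi u (g i) = adj_table i.
Proof.
move=> hi; apply: (@form_family_inj _ _ phi 1 (mulr1 1) 5 e (osp_dim0 osp) heg.1) => [j hj|].
  rewrite (osp_adjE osp) hu //.
  do 4?[case: i hi => [|i] hi //]; do 5?[case: j hj => [|j] hj //];
   by rewrite /= ?bformE ?psiE ?phiE //= ?oppr0 ?opprK.
exact: osp_phi_nd osp.
Qed.

Let adj_expand y0 y1 y2 y3 :
  adj phi psi u (y0 *: g 0%N + y1 *: g 1%N + y2 *: g 2%N + y3 *: g 3%N) =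
  y1 *: e 2%N - y2 *: e 3%N - y3 *: e 4%N.
Proof.
by rewrite !linearD !linearZ /= !adjE //= scaler0 add0r !scalerN.
Qed.


Let fiber := springer_fiber phi psi 2 u.

Let fiber_frame P Q E F : frame P E -> frame Q F -> fiber (u, E, F) <->
  [/\ [/\ phi (P ord0) (P ord0) = 0, phi (P ord0) (P ord2_1) = 0,
          phi (P ord2_1) (P ord2_1) = 0 & psi (Q ord0) (Q ord2_1) = 0],
      u (P ord0) = 0, u (P ord2_1) \in <[Q ord0]>%VS,
      adj phi psi u (Q ord0) \in <[P ord0]>%VS &
      adj phi psi u (Q ord2_1) \in (<[P ord0]> + <[P ord2_1]>)%VS].
Proof.
move=> hP hQ; rewrite -(frame2_w1 hQ) -(frame2_2 hP) -(frame2_1 hP).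
split=> [/(springer_fiber_frame phi psi u hP hQ)[h1 h2 h3]|].
  have [/flag_widen0 a1 a2] := h3 ord0; have [a3 a4] := h3 ord2_1.
  by split.
move=> [[p00 p01 p11 q01] up0 up1 aq0 aq1].
apply/(springer_fiber_frame phi psi u hP hQ); split.
- apply: ord2P; apply: ord2P => //.
  by rewrite (osp_phiC osp).
- apply: ord2P; apply: ord2P; rewrite ?(osp_psixx osp) //.
  by rewrite (osp_psiC osp) q01 oppr0.
- by apply: ord2P; rewrite ?up0 ?mem0v.
Qed.

(** The coefficient of [e 4] is the one that makes the second vector isotropic. *)
Let line_frame0 (y : K) := pair_family (e 3%N) (e 0%N + y *: e 2%N - (y ^+ 2 / 2) *: e 4%N).
Let line_frame1 (y : K) := pair_family (g 0%N + y *: g 2%N) (g 2%N).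

(** A surface with [E_2 = <e_3, e_4>]. The adjoint of [u] sends the first vector of [surf_frame1] to
    minus that of [surf_frame0], so [s] is shared; [w] is free because the adjoint kills [g 0]. *)
Let surf_frame0 (s : K) := pair_family (s *: e 3%N + e 4%N) (e 3%N).
Let surf_frame1 (s w : K) := pair_family (s *: g 2%N + g 3%N + w *: g 0%N) (g 2%N).

Let table := (bformE, oppr0, addr0, add0r, mulr0, mulr1, mul0r, mul1r).

Let line_flags (y : K) : exists z : flag_pairs 2 V0 V1,
  [/\ z.1.1 = u, frame (line_frame0 y) z.1.2 & frame (line_frame1 y) z.2].
Proof.
have [||| E hE] := @exists_flag2 _ _ phi (e 3%N) (e 0%N + y *: e 2%N - (y ^+ 2 / 2) *: e 4%N)
    (e 1%N) (e 4%N).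
- by rewrite phiE //= oner_eq0.
- by rewrite !bformE !phiE //= !table.
- by rewrite !bformE !phiE //= !table oner_eq0.
have [||| F hF] := @exists_flag2 _ _ psi (g 0%N + y *: g 2%N) (g 2%N) (g 3%N) (g 1%N).
- by rewrite !bformE !psiE //= !table oner_eq0.
- by rewrite psiE.
- by rewrite psiE //= oppr_eq0 oner_eq0.
by exists (u, E, F).
Qed.

Let surf_flags (sw : K * K) : exists z : flag_pairs 2 V0 V1,
  [/\ z.1.1 = u, frame (surf_frame0 sw.1) z.1.2 & frame (surf_frame1 sw.1 sw.2) z.2].
Proof.
case: sw => s w /=.
have [||| E hE] := @exists_flag2 _ _ phi (s *: e 3%N + e 4%N) (e 3%N) (e 0%N) (e 1%N).
- by rewrite !bformE !phiE //= !table oner_eq0.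
- by rewrite phiE.
- by rewrite phiE //= oner_eq0.
have [||| F hF] := @exists_flag2 _ _ psi (s *: g 2%N + g 3%N + w *: g 0%N) (g 2%N) (g 0%N) (g 1%N).
- by rewrite !bformE !psiE //= !table oppr_eq0 oner_eq0.
- by rewrite psiE.
- by rewrite psiE //= oppr_eq0 oner_eq0.
by exists (u, E, F).
Qed.

Let line_fiber y z : z.1.1 = u -> frame (line_frame0 y) z.1.2 -> frame (line_frame1 y) z.2 ->
  fiber z.
Proof.
case: z => [[u' E] F] /= -> hP hQ; apply/(fiber_frame hP hQ).
rewrite !(pair_family0, pair_family1); split.
- split; rewrite ?bformE ?phiE ?psiE //= ?table //.
  by rewrite expr2; field.
- by rewrite hu.
- by rewrite !linearD linearN !linearZ /= !hu //= oppr0 scaler0 addr0 memv_line.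
- by rewrite linearD linearZ /= !adjE //= add0r scalerN rpredN rpredZ ?memv_line.
- by rewrite adjE //= rpredN; apply: (subvP (addvSl _ _)); apply: memv_line.
Qed.

Let surf_fiber s w z : z.1.1 = u -> frame (surf_frame0 s) z.1.2 -> frame (surf_frame1 s w) z.2 ->
  fiber z.
Proof.
case: z => [[u' E] F] /= -> hP hQ; apply/(fiber_frame hP hQ).
rewrite !(pair_family0, pair_family1); split.
- by split; rewrite ?bformE ?phiE ?psiE //= ?table.
- by rewrite linearD linearZ /= !hu //= scaler0 addr0.
- by rewrite hu // mem0v.
- rewrite !linearD !linearZ /= !adjE //= scaler0 addr0 scalerN -opprD rpredN.
  exact: memv_line.
- by rewrite adjE //= rpredN; apply: (subvP (addvSr _ _)); apply: memv_line.
Qed.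

(* Outside of the closed set [E_2 = <e_3, e_4>] the fiber is the affine line. *)
Let fiber_dichotomy z : fiber z ->
  (z.1.2 ord3_2 <= <[e 3%N]> + <[e 4%N]>)%VS \/
  exists y, frame (line_frame0 y) z.1.2 /\ frame (line_frame1 y) z.2.
Proof.
case: z => [[u' E] F] fz; have u'E : u' = u by case: fz.
rewrite {}u'E in fz *.
have [P hP] := exists_frame E; have [Q hQ] := exists_frame F.
have [[p00 p01 p11 q01] up0 up1 aq0 aq1] := (fiber_frame hP hQ).1 fz.
rewrite /=.
have [a0 [a1 [a2 [a3 [a4 p0E]]]]] := phi_expand (P ord0).
have [b0 [b1 [b2 [b3 [b4 p1E]]]]] := phi_expand (P ord2_1).
have [d0 [d1 [d2 [d3 q1E]]]] := psi_expand (Q ord2_1).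
(* Pairing with a basis vector reads off, up to sign, the coordinate at the mirror index. *)
have psi3 j := congr1 (fun v : V1 => psi v (g j)).
have phi3 j := congr1 (fun v : V0 => phi v (e j)).
have a00 : a0 = 0.
  by move: up0; rewrite p0E uE => /(psi3 3%N); rewrite /= !bformE !psiE //= !table.
have a10 : a1 = 0.
  by move: up0; rewrite p0E uE => /(psi3 2%N); rewrite /= !bformE !psiE //= !table.
have a20 : a2 = 0.
  move: up0; rewrite p0E uE => /(psi3 1%N); rewrite /= !bformE !psiE //= !table.
  by rewrite mulrN1 => /eqP; rewrite oppr_eq0 => /eqP.
rewrite a00 a10 a20 !scale0r !add0r in p0E.
have [k up1E] : exists k, u (P ord2_1) = k *: Q ord0 by apply/vlineP.
have [c aq0E] : exists c, adj phi psi u (Q ord0) = c *: P ord0 by apply/vlineP.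
(* The vector [u^* u (P ord2_1)] lies in [E_1], hence in [<e_3, e_4>], and its coordinate on [e 2]
   is [b1]. *)
have b10 : b1 = 0.
  have : adj phi psi u (u (P ord2_1)) = (k * c) *: P ord0.
    by rewrite up1E linearZ /= aq0E scalerA.
  have -> : u (P ord2_1) = b0 *: g 0%N + b1 *: g 1%N + b2 *: g 2%N + 0 *: g 3%N.
    by rewrite p1E uE scale0r addr0.
  by rewrite adj_expand p0E => /(phi3 2%N); rewrite /= !bformE !phiE //= !table.
rewrite b10 scale0r addr0 in p1E.
have sq : 2 * (b0 * b4) + b2 * b2 = 0.
  move: p11; rewrite p1E !bformE !phiE //= !table => <-; ring.
(* If [b0 = 0], isotropy also gives [b2 = 0], so [E_2] is [<e_3, e_4>]; otherwise the slope
   [b2 / b0] is the parameter on the line. *)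
have [b00|b0n] := eqVneq b0 0.
  left; rewrite (frame2_2 hP) subv_add -!memvE.
  have b20 : b2 = 0 by move/eqP: sq; rewrite b00 mul0r mulr0 add0r mulf_eq0 orbb => /eqP.
  by rewrite p0E p1E b00 b20 !scale0r !add0r !span2_mem.
right; pose y := b2 / b0; exists y.
have a40 : a4 = 0.
  move: p01; rewrite p0E p1E !bformE !phiE //= !table => /eqP.
  by rewrite mulf_eq0 (negbTE b0n) ?orbF /= => /eqP.
rewrite a40 scale0r addr0 in p0E.
have b4E : b4 = - (b0 * (y ^+ 2 / 2)).
  apply: (mulfI b0n); apply: (mulfI (_ : 2 != 0)); first by rewrite pnatr_eq0.
  apply/eqP; rewrite -subr_eq0 -sq /y; apply/eqP; field.
  by rewrite b0n.
have up1v : u (P ord2_1) = b0 *: g 0%N + b2 *: g 2%N.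
  by rewrite p1E !linearD !linearZ /= !hu //= !scaler0 !addr0.
have kn : k != 0.
  apply: contraNneq b0n => k0.
  have := up1v; rewrite up1E k0 scale0r => /(psi3 3%N).
  by rewrite /= !bformE !psiE //= !table => <-.
(* [F_1] is spanned by [u (P ord2_1)], which is nonzero because [b0] is. *)
have q0E : Q ord0 = (k^-1 * b0) *: (g 0%N + y *: g 2%N).
  apply: (scalerI kn); rewrite -up1E up1v.
  by rewrite !scalerDr !scalerA /y !mulrA mulfV // mul1r mulrAC mulfV // mul1r.
have [al [be aq1E]] := mem_span2 aq1.
rewrite q1E adj_expand p0E p1E in aq1E.
(* No vector in the image of the adjoint has a component on [e 0], whereas [P ord2_1] has the
   nonzero one [b0]. *)
have be0 : be = 0.
  move: aq1E => /(phi3 4%N); rewrite /= !bformE !phiE //= !table => /esym/eqP.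
  by rewrite mulf_eq0 (negbTE b0n) orbF => /eqP.
rewrite be0 scale0r addr0 in aq1E.
have d10 : d1 = 0 by move: aq1E => /(phi3 2%N); rewrite /= !bformE !phiE //= !table.
have d30 : d3 = 0.
  move: aq1E => /(phi3 0%N); rewrite /= !bformE !phiE //= !table => /eqP.
  by rewrite oppr_eq0 => /eqP.
rewrite d10 d30 !scale0r !addr0 in q1E.
(* Frames of a flag are not unique, so the flags themselves are compared with those of the point
   [y]. *)
have [[[u'' E'] F'] [_ /= hE' hF']] := line_flags y.
have -> : E = E'.
  apply: (frame_inj hP); apply: ord2P.
    rewrite (frame2_1 hE') pair_family0 p0E; exact/rpredZ/memv_line.
  rewrite (frame2_2 hE') pair_family0 pair_family1 p1E.
  apply/memv_addP; exists (b3 *: e 3%N); first exact/rpredZ/memv_line.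
  exists (b0 *: (e 0%N + y *: e 2%N - (y ^+ 2 / 2) *: e 4%N)); first exact/rpredZ/memv_line.
  have b2E : b2 = b0 * y by rewrite mulrC divfK.
  rewrite b2E b4E scaleNr scalerBr scalerDr !scalerA [RHS]addrA; congr (_ + _).
  by rewrite addrC.
have -> // : F = F'.
apply: (frame_inj hQ); apply: ord2P.
  rewrite (frame2_1 hF') pair_family0 q0E; exact/rpredZ/memv_line.
rewrite (frame2_2 hF') pair_family0 pair_family1 q1E.
have -> : d0 *: g 0%N + d2 *: g 2%N = d0 *: (g 0%N + y *: g 2%N) + (d2 - d0 * y) *: g 2%N.
  by rewrite scalerDr scalerA -addrA -scalerDl [d0 * y + _]addrC subrK.
exact: span2_mem.
Qed.

Let line_curve (q : {poly K}) : polycurve (fun t => (u, line_frame0 q.[t], line_frame1 q.[t])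
  : frame_pairs 2 V0 V1).
Proof.
pose P (i : 'I_2) t := if i == ord0 then e 3%N else
  e 0%N + q.[t] *: e 2%N + (- 2^-1 *: q ^+ 2).[t] *: e 4%N.
pose Q (i : 'I_2) t := if i == ord0 then g 0%N + q.[t] *: g 2%N else g 2%N.
have hP : forall i, polycurve (P i).
  apply: ord2P; first exact: polycurve_cst.
  apply: polycurveD (polycurve_scale _ _).
  exact: polycurveD (polycurve_cst _) (polycurve_scale _ _).
have hQ : forall i, polycurve (Q i).
  apply: ord2P; last exact: polycurve_cst.
  exact: polycurveD (polycurve_cst _) (polycurve_scale _ _).
move=> l hl; have [r hr] := polycurve_frames u hP hQ hl; exists r => t.
rewrite -hr; congr (l (_, _, _)); apply/ffunP => i; rewrite !ffunE //.
rewrite /P; case: ifP => // _; rewrite hornerZ horner_exp -scaleNr; congr (_ + _ *: _).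
by rewrite mulNr mulrC.
Qed.

Let surf_curve (q r : {poly K}) :
  polycurve (fun t => (u, surf_frame0 q.[t], surf_frame1 q.[t] r.[t]) : frame_pairs 2 V0 V1).
Proof.
pose P (i : 'I_2) t := if i == ord0 then q.[t] *: e 3%N + e 4%N else e 3%N.
pose Q (i : 'I_2) t := if i == ord0 then q.[t] *: g 2%N + g 3%N + r.[t] *: g 0%N else g 2%N.
have hP : forall i, polycurve (P i).
  apply: ord2P; last exact: polycurve_cst.
  exact: polycurveD (polycurve_scale _ _) (polycurve_cst _).
have hQ : forall i, polycurve (Q i).
  apply: ord2P; last exact: polycurve_cst.
  apply: polycurveD (polycurve_scale _ _).
  exact: polycurveD (polycurve_scale _ _) (polycurve_cst _).
move=> l hl; have [p hp] := polycurve_frames u hP hQ hl; exists p => t.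
by rewrite -hp; congr (l (_, _, _)); apply/ffunP => i; rewrite !ffunE.
Qed.

(** * The closure of the affine line and its point at infinity *)

Local Notation T := (flag_pairs 2 V0 V1).

Let special : set T := [set z : T | (z.1.2 ord3_2 <= <[e 3%N]> + <[e 4%N]>)%VS].

(** In coordinates this is [2 x_4 y_0 + x_2 y_2]. It vanishes for [E_2] and [F_1] along the line,
    hence on its closure, and there determines [F_1] at infinity. *)
Let rel (x : V0) (y : V1) : K := 2 * phi x (e 0%N) * psi y (g 3%N) - phi x (e 2%N) * psi y (g 1%N).

(** Closed conditions satisfied on the affine line; once [E_2 = <e_3, e_4>] is added they leave only
    one pair of flags. *)
Let around : set T := [set z : T | (z.1.2 ord3_1 <= <[e 3%N]>)%VS] `&`
  [set z : T | (z.2 ord3_2 <= <[g 0%N]> + <[g 2%N]>)%VS] `&`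
  [set z : T | forall x y, x \in z.1.2 ord3_2 -> y \in z.2 ord3_1 -> rel x y = 0].

Let closed_special : closed special. Proof. exact: closed_flag_sub0. Qed.

Let closed_around : closed around.
Proof.
apply: closedI; first by apply: closedI; [exact: closed_flag_sub0|exact: closed_flag_sub1].
by apply: closed_flag_bilinear => x a y z; rewrite /rel !bformE; ring.
Qed.

Let flag2_eq (V : vectType K) (E E' : flag 2 V) :
  E ord3_1 = E' ord3_1 -> E ord3_2 = E' ord3_2 -> E = E'.
Proof.
move=> h1 h2; apply: flag_inj => -[[|[|[|//]]] h].
- have : \dim (E (Ordinal h)) == 0%N by rewrite flag_dim.
  by rewrite dimv_eq0 => /eqP->; apply: sub0v.
- by rewrite (_ : Ordinal h = ord3_1) ?h1 //; apply: val_inj.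
- by rewrite (_ : Ordinal h = ord3_2) ?h2 //; apply: val_inj.
Qed.

Let dim_span2 (V : vectType K) (x y : V) : (\dim (<[x]> + <[y]>) <= 2)%N.
Proof.
apply: leq_trans (dimv_add_leqif _ _).1 _.
by rewrite !dim_vline; case: (x != 0); case: (y != 0).
Qed.

Let special_around z : special z -> around z ->
  [/\ z.1.2 ord3_1 = <[e 3%N]>%VS, z.1.2 ord3_2 = (<[e 3%N]> + <[e 4%N]>)%VS,
      z.2 ord3_1 = <[g 2%N]>%VS & z.2 ord3_2 = (<[g 0%N]> + <[g 2%N]>)%VS].
Proof.
move=> hs [[hE hF] hR].
have E2 : z.1.2 ord3_2 = (<[e 3%N]> + <[e 4%N]>)%VS.
  by apply/eqP; rewrite eqEdim hs flag_dim dim_span2.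
have F2 : z.2 ord3_2 = (<[g 0%N]> + <[g 2%N]>)%VS.
  by apply/eqP; rewrite eqEdim hF flag_dim dim_span2.
split=> //; apply/eqP; rewrite eqEdim flag_dim dim_vline.
  by rewrite hE leq_b1.
rewrite leq_b1 andbT; apply/subvP => y yF.
have : y \in z.2 ord3_2 by apply: (subvP (flag_sub _ _)) yF.
rewrite F2 => /mem_span2[a [b yE]].
have : rel (e 4%N) y = 0.
  by apply: hR yF; rewrite E2 (subvP (addvSr _ _)) ?memv_line.
rewrite /rel yE !bformE !phiE //= !psiE //= !table => /eqP.
rewrite mulf_eq0 pnatr_eq0 /= => /eqP->.
by rewrite scale0r add0r rpredZ ?memv_line.
Qed.

Let special_around_inj z z' : z.1.1 = z'.1.1 -> special z -> around z ->
  special z' -> around z' -> z = z'.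
Proof.
case: z z' => [[w E] F] [[w' E'] F'] /= -> hs ha hs' ha'.
have [h1 h2 h3 h4] := special_around hs ha.
have [h1' h2' h3' h4'] := special_around hs' ha'.
by rewrite (flag2_eq (E := E) (E' := E')) ?h1 ?h2 // (flag2_eq (E := F) (E' := F')) ?h3 ?h4.
Qed.


Let line_around y z : frame (line_frame0 y) z.1.2 -> frame (line_frame1 y) z.2 -> around z.
Proof.
move=> hP hQ; split; [split|].
- by rewrite /= (frame2_1 hP) pair_family0.
- rewrite /= (frame2_2 hQ) pair_family0 pair_family1 subv_add addvSr andbT -memvE.
  by rewrite -{1}[g 0%N]scale1r span2_mem.
- move=> x x'; rewrite (frame2_2 hP) (frame2_1 hQ) !(pair_family0, pair_family1).
  move=> /mem_span2[a [b ->]] /vlineP[c ->].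
  by rewrite /rel !bformE !phiE //= !psiE //= !table; field.
Qed.

Let line_not_special y z : frame (line_frame0 y) z.1.2 -> ~ special z.
Proof.
move=> hP; rewrite /special /= (frame2_2 hP) pair_family0 pair_family1.
rewrite subv_add => /andP[_]; rewrite -memvE => /mem_span2[a [b E]].
have := congr1 (fun v => phi v (e 4%N)) E.
by rewrite !bformE !phiE //= !table => /eqP; rewrite oner_eq0.
Qed.

(** A closed set that isolates the point [y] of the line and avoids the point at infinity. *)
Let at_line y : set T := [set z : T | (z.2 ord3_1 <= <[(g 0%N + y *: g 2%N)%R]>)%VS].

Let special_not_at_line y z : special z -> around z -> ~ at_line y z.
Proof.
move=> hs ha; have [_ _ F1 _] := special_around hs ha.
rewrite /at_line /= F1 -memvE => /vlineP[k E].
have := congr1 (fun v => psi v (g 3%N)) E; have := congr1 (fun v => psi v (g 1%N)) E.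
rewrite !bformE !psiE //= !table => /eqP h k0.
by move: h; rewrite -k0 mul0r oppr_eq0 oner_eq0.
Qed.

Let line_at_line y y' z : frame (line_frame1 y') z.2 -> at_line y z -> y' = y.
Proof.
move=> hQ; rewrite /at_line /= (frame2_1 hQ) pair_family0 -memvE => /vlineP[k E].
have := congr1 (fun v => psi v (g 3%N)) E; have := congr1 (fun v => psi v (g 1%N)) E.
rewrite !bformE !psiE //= !table => /eqP h k0.
move: h; rewrite -k0 !mulrN1 mul1r eqr_opp.
by move/eqP.
Qed.

(** Pulled back to the parameter, an equation of [F] that fails somewhere is a nonzero polynomial,
    with finitely many roots. *)
Let closed_on_line (zL : K -> T) (F : set T) :
    (forall y, [/\ (zL y).1.1 = u, frame (line_frame0 y) (zL y).1.2 &
                   frame (line_frame1 y) (zL y).2]) ->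
    closed F ->
  (forall y, F (zL y)) \/ exists s : seq K, forall y, F (zL y) -> y \in s.
Proof.
move=> hL /closed_flag_pairsE[S hS].
have memF y : F (zL y) <->
    (forall p, S p -> @peval K (frame_pairs 2 V0 V1) p (u, line_frame0 y, line_frame1 y) = 0).
  have [<- hP hQ] := hL y; move: hP hQ; case: (zL y) => [[u' E] F'] /=; exact: hS.
have [allF|/existsNP[y0 nF]] := pselect (forall y, F (zL y)); [by left|right].
have /existsNP[p /not_implyP[Sp py0]] :
    ~ (forall p, S p -> @peval K (frame_pairs 2 V0 V1) p (u, line_frame0 y0, line_frame1 y0) = 0).
  by move=> H; apply: nF; apply/memF.
have [q hq] := peval_polycurve p (line_curve 'X).
have q0 : q != 0.
  by apply/eqP => q0; apply: py0; have := hq y0; rewrite hornerX q0 horner0.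
have [s qE] := closed_field_poly_normal q.
exists s => y /memF/(_ _ Sp) py.
have : root q y by apply/rootP; rewrite -hq hornerX.
by rewrite qE rootZ ?lead_coef_eq0 // root_prod_XsubC.
Qed.

(** In a chain of length 2 the middle term would either contain the whole line, hence be all of [B],
    or be reduced to one point; both contradict strict inclusions. *)
Let line_component (zL : K -> T) (B : set T) :
    (forall y, [/\ (zL y).1.1 = u, frame (line_frame0 y) (zL y).1.2 &
                   frame (line_frame1 y) (zL y).2]) ->
    irreducible_component fiber B -> range zL `<=` B ->
  ~ exists c, irreducible_chain B 2 c.
Proof.
move=> hL [Bfib irrB _] LB [c [hc sc]].
have ns y : ~ special (zL y) by have [_ hP _] := hL y; apply: line_not_special hP.
have Bdich z : B z -> special z \/ exists y, z = zL y.
  move=> /Bfib fz; have [h|[y [hP hQ]]] := fiber_dichotomy fz; [by left|right; exists y].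
  have [h1 h2 h3] := hL y; move: h1 h2 h3 hP hQ; have u1 : z.1.1 = u by case: fz.
  case: z u1 {fz} => [[u1 E] F] /= ->; case: (zL y) => [[u2 E2] F2] /= -> hP' hQ' hP hQ.
  by congr (_, _, _); apply: val_inj; apply/ffunP => i; rewrite /= ?hP ?hP' ?hQ ?hQ'.
(* [B] is irreducible, covered by [special] and the closure of the line, and not contained in
   [special]. *)
have Bcl : B `<=` closure (range zL).
  have [_ irr] := irrB.
  case: (irr special (closure (range zL)) closed_special (@closed_closure _ (range zL))) => //.
    move=> z /Bdich[|[y ->]]; [by left|right].
    by apply: subset_closure; exists y.
  by move=> Bs; case: (ns 0); apply: Bs; apply: LB; exists 0.
have Bar : B `<=` around.
  apply: (subset_trans Bcl); rewrite [X in _ `<=` X](closure_id _).1 //.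
  by apply: closure_subset => _ [y _ <-]; have [_ hP hQ] := hL y; apply: line_around hP hQ.
have [[irr0 [F0 cF0 c0E]] [irr1 [F1 cF1 c1E]]] := (hc 0%N isT, hc 1%N isT).
have [_ [F2 cF2 c2E]] := hc 2%N isT.
have [c01 n10] := sc 0%N isT; have [c12 n21] := sc 1%N isT.
have [[z0 cz0] _] := irr0.
have single : (forall z z', c 1%N z -> c 1%N z' -> z = z') -> False.
  move=> H; apply: n10 => z cz; by rewrite (H z z0) //; apply: c01.
have Bu z : B z -> z.1.1 = u by move=> /Bfib [].
have c1B : c 1%N `<=` B by rewrite c1E => z [].
have [allF|[s hs]] := closed_on_line hL cF1.
  apply: n21; rewrite c1E c2E => z [Bz _]; split=> //.
  have : closure (range zL) `<=` F1.
    rewrite [X in _ `<=` X](closure_id _).1 //.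
    by apply: closure_subset => _ [y _ <-].
  by apply; apply: Bcl.
(* The middle term consists of points with [E_2 = <e_3, e_4>] and finitely many points of the line;
   irreducibility selects one of these closed pieces, each of which meets it in at most one
   point. *)
have [||sp|[y hy]] := @irreducible_sub_big _ (c 1%N) _ s special at_line irr1 closed_special.
- by move=> y; apply: closed_flag_sub1.
- move=> z c1z; have [|[y zE]] := Bdich _ (c1B _ c1z); [by left|right].
  have [_ _ hQ] := hL y; exists y; last first.
    by rewrite zE /at_line /= (frame2_1 hQ) pair_family0.
  by apply: hs; rewrite -zE; move: c1z; rewrite c1E => -[].
- apply: single => z z' cz cz'.
  have [Bz Bz'] := (c1B _ cz, c1B _ cz').
  apply: special_around_inj; first by rewrite (Bu z Bz) (Bu z' Bz').
  - exact: sp.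
  - exact: Bar.
  - exact: sp.
  - exact: Bar.
- apply: single => z z' cz cz'.
  have onL z1 : c 1%N z1 -> z1 = zL y.
    move=> cz1; have at1 := hy _ cz1; have [h|[y' z1E]] := Bdich _ (c1B _ cz1).
      by case: (special_not_at_line h (Bar _ (c1B _ cz1)) at1).
    by rewrite z1E in at1 *; have [_ _ hQ] := hL y'; rewrite (line_at_line hQ at1).
  by rewrite (onL z cz) (onL z' cz').
Qed.

(** * Irreducibility of the line and the surface, and a chain of length 2 *)

Let segment (a b : K) : {poly K} := a%:P + (b - a) *: 'X.

Let segment0 a b : (segment a b).[0] = a.
Proof. by rewrite hornerD hornerC hornerZ hornerX mulr0 addr0. Qed.

Let segment1 a b : (segment a b).[1] = b.
Proof. by rewrite hornerD hornerC hornerZ hornerX mulr1 addrC subrK. Qed.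

Let irreducible_line (zL : K -> T) :
    (forall y, [/\ (zL y).1.1 = u, frame (line_frame0 y) (zL y).1.2 &
                   frame (line_frame1 y) (zL y).2]) ->
  irreducible (range zL).
Proof.
move=> hL; apply: irreducible_of_curves; first by exists (zL 0), 0.
move=> _ _ [y1 _ <-] [y2 _ <-].
exists (fun t => zL (segment y1 y2).[t]), (fun t => line_frame0 (segment y1 y2).[t]),
  (fun t => line_frame1 (segment y1 y2).[t]); split.
- by move=> t; have [_ h1 h2] := hL (segment y1 y2).[t]; split; [exists (segment y1 y2).[t]|].
- move=> l hl; have [q hq] := line_curve (segment y1 y2) hl; exists q => t.
  by rewrite -hq; have [-> _ _] := hL (segment y1 y2).[t].
- by rewrite segment0.
- by rewrite segment1.
Qed.

(** The factor [k] treats two cases together: [k = 1] is the surface, [k = 0] the curve [w = 0] in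
    it. *)
Let irreducible_surf (zS : K * K -> T) (k : K) :
    (forall sw, [/\ (zS sw).1.1 = u, frame (surf_frame0 sw.1) (zS sw).1.2 &
                    frame (surf_frame1 sw.1 sw.2) (zS sw).2]) ->
  irreducible (range (fun sw => zS (sw.1, k * sw.2))).
Proof.
move=> hS; apply: irreducible_of_curves; first by exists (zS (0, k * 0)), (0, 0).
move=> _ _ [[s1 w1] _ <-] [[s2 w2] _ <-] /=.
pose q := segment s1 s2; pose r := segment (k * w1) (k * w2).
have rE t : r.[t] = k * (segment w1 w2).[t] by rewrite !hornerD !hornerC !hornerZ !hornerX; ring.
exists (fun t => zS (q.[t], r.[t])), (fun t => surf_frame0 q.[t]),
  (fun t => surf_frame1 q.[t] r.[t]); split.
- move=> t; have [_ h1 h2] := hS (q.[t], r.[t]); split => //.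
  by exists (q.[t], (segment w1 w2).[t]) => //=; rewrite rE.
- move=> l hl; have [p hp] := surf_curve q r hl; exists p => t.
  by rewrite -hp; have [-> _ _] := hS (q.[t], r.[t]).
- by rewrite !segment0.
- by rewrite !segment1.
Qed.

(** The chain is a point, the curve [w = 0] and [A], the first two replaced by their closures in
    [A]. *)
Let surf_chain (zS : K * K -> T) (A : set T) :
    (forall sw, [/\ (zS sw).1.1 = u, frame (surf_frame0 sw.1) (zS sw).1.2 &
                    frame (surf_frame1 sw.1 sw.2) (zS sw).2]) ->
    irreducible A -> range zS `<=` A ->
  exists c, irreducible_chain A 2 c.
Proof.
move=> hS irrA SA.
pose L := range (fun sw : K * K => zS (sw.1, 0 * sw.2)).
have LS s : L (zS (s, 0)) by exists (s, 0) => //=; rewrite mul0r.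
have LA : L `<=` A by move=> _ [sw _ <-]; apply: SA; exists (sw.1, 0 * sw.2).
pose P := [set zS (0, 0)].
have PL : P `<=` L by move=> _ ->; exact: LS.
have irrP : irreducible P.
  split; first by exists (zS (0, 0)).
  by move=> F G _ _ /(_ _ erefl)[h|h]; [left|right] => _ ->.
exists (fun i => match i with 0%N => A `&` closure P | 1%N => A `&` closure L | _ => A end).
split=> [[|[|[|//]]] _|[|[|//]] _].
- split; first exact: irreducible_closure irrP (subset_trans PL LA).
  by exists (closure P) => //; exact: closed_closure.
- split; first exact: irreducible_closure (irreducible_surf 0 hS) LA.
  by exists (closure L) => //; exact: closed_closure.
- by split=> //; exists setT; [exact: closedT|rewrite setIT].
- split; first by move=> z [Az Pz]; split=> //; exact: closure_subset Pz.
  (* The closed condition [E_1 = <e_4>] holds at [s = 0] and fails at [s = 1]. *)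
  move=> sub; pose F := [set z : T | (z.1.2 ord3_1 <= <[e 4%N]>)%VS].
  have cF : closed F by apply: closed_flag_sub0.
  have PF : closure P `<=` F.
    rewrite [X in _ `<=` X](closure_id _).1 //; apply: closure_subset => _ ->.
    have [_ hP _] := hS (0, 0).
    by rewrite /F /= (frame2_1 hP) pair_family0 scale0r add0r subvv.
  have [|_ /PF] := sub (zS (1, 0)).
    by split; [apply: LA|apply: subset_closure]; exact: LS.
  have [_ hP _] := hS (1, 0).
  rewrite /F /= (frame2_1 hP) pair_family0 -memvE => /vlineP[k E].
  have := congr1 (fun v => phi v (e 1%N)) E.
  by rewrite !bformE !phiE //= !table => /eqP; rewrite oner_eq0.
- split; first by move=> z [].
  (* On the curve [w = 0] the line [F_1] stays in [<g_2, g_3>], but not at [w = 1]. *)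
  move=> sub; pose F := [set z : T | (z.2 ord3_1 <= <[g 2%N]> + <[g 3%N]>)%VS].
  have cF : closed F by apply: closed_flag_sub1.
  have LF : closure L `<=` F.
    rewrite [X in _ `<=` X](closure_id _).1 //; apply: closure_subset => _ [[s w] _ <-] /=.
    have [_ _ hQ] := hS (s, 0 * w).
    rewrite /F /= (frame2_1 hQ) pair_family0 /= mul0r scale0r addr0 -memvE.
    by rewrite -{1}[g 3%N]scale1r span2_mem.
  have [|_ /LF] := sub (zS (0, 1)); first by apply: SA; exists (0, 1).
  have [_ _ hQ] := hS (0, 1).
  rewrite /F /= (frame2_1 hQ) pair_family0 -memvE => /mem_span2[a [b E]].
  have := congr1 (fun v => psi v (g 3%N)) E.
  by rewrite !bformE !psiE //= !table => /eqP; rewrite oner_eq0.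
Qed.

Lemma odd_nilcone_two_components : odd_nilcone phi psi u.
Proof.
apply: (odd_nilcone_chain osp heg) => i i4; rewrite comp_lfunE hu //.
move: i i4; do 5?[case=> [|]] => //= _.
- by exists 0; rewrite adjE // scale0r.
- by exists 1; rewrite adjE // scale1r.
- by exists (-1); rewrite adjE // scaleN1r.
- by exists 0; rewrite linear0 scale0r.
- by exists 0; rewrite linear0.
Qed.

Lemma fiber_not_equidimensional : ~ equidimensional (springer_fiber phi psi 2 u).
Proof.
have /boolp.choice[zL hL] := line_flags; have /boolp.choice[zS hS] := surf_flags.
have irrS : irreducible (range zS).
  rewrite (_ : zS = fun sw => zS (sw.1, 1 * sw.2)); first exact: irreducible_surf.
  by apply/funext => -[s w]; rewrite mul1r.
have Sfib : range zS `<=` fiber.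
  by move=> _ [sw _ <-]; have [h1 h2 h3] := hS sw; apply: surf_fiber h1 h2 h3.
have Lfib : range zL `<=` fiber.
  by move=> _ [y _ <-]; have [h1 h2 h3] := hL y; apply: line_fiber h1 h2 h3.
have [A cA SA] := irreducible_component_sup irrS Sfib.
have [B cB LB] := irreducible_component_sup (irreducible_line hL) Lfib.
have [_ irrA _] := cA; have [c hc] := surf_chain hS irrA SA.
exact: not_equidimensional_of_chains cA cB hc (line_component hL cB LB).
Qed.

End NotEquidimensional.

Theorem exists_nonequidimensional_fiber (K : numClosedFieldType) (V0 V1 : vectType K)
    (phi : 'Hom(V0, dual V0)) (psi : 'Hom(V1, dual V1)) : osp_form phi psi 2 ->
  exists2 u : 'Hom(V0, V1), odd_nilcone phi psi u &
    ~ equidimensional (springer_fiber phi psi 2 u).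
Proof.
move=> osp; have [e [g heg]] := exists_osp_basis osp.
have [u hu] := @hom_of_family _ _ phi 1 (mulr1 1) _ e (osp_dim0 osp) heg.1 V1
  (fun i => if (i < 3)%N then g i else 0).
exists u; first exact (odd_nilcone_two_components osp heg hu).
exact (fiber_not_equidimensional osp heg hu).
Qed.

(** * The three assertions over the complex numbers *)

Theorem proposition0p1 (R : realType) :
  [/\ exists2 n : nat, (1 <= n)%N &
        forall (V0 V1 : vectType R[i])
          (phi : 'Hom(V0, dual V0)) (psi : 'Hom(V1, dual V1)),
        osp_form phi psi n ->
        exists2 u : 'Hom(V0, V1), odd_nilcone phi psi u &
          ~ connected (springer_fiber phi psi n u),
      exists2 n : nat, (1 <= n)%N &
        forall (V0 V1 : vectType R[i])
          (phi : 'Hom(V0, dual V0)) (psi : 'Hom(V1, dual V1)),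
        osp_form phi psi n ->
        exists2 u : 'Hom(V0, V1), odd_nilcone phi psi u &
          ~ equidimensional (springer_fiber phi psi n u) &
      forall n : nat, (1 <= n)%N ->
        forall (V0 V1 : vectType R[i])
          (phi : 'Hom(V0, dual V0)) (psi : 'Hom(V1, dual V1)),
        osp_form phi psi n ->
        ~ normal_variety (odd_nilcone phi psi)].
Proof.
split.
- by exists 1%N => // V0 V1 phi psi; apply: exists_disconnected_fiber.
- by exists 2%N => // V0 V1 phi psi; apply: exists_nonequidimensional_fiber.
- by move=> n n0 V0 V1 phi psi osp; exact: odd_nilcone_not_normal osp n0.
Qed.
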